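(* Let $A$ be a commutative, noetherian, reduced ring with identity, $I\subset A[x]=A[x_1,\ldots,x_n]$ an ideal, $<$ a term order, and let $L$ be a locally closed subset of $\operatorname{Spec}(A)$. Then there exists exactly one irreducible, small and locally maximal Gröbner cover of $L$ (with respect to $I$ and $<$).
   Context: Standing setting: $A$ is a commutative, noetherian, reduced ring with identity, $I$ is an ideal of $A[x]=A[x_1,\ldots,x_n]$, $\mathcal{T}$ is the set of terms (power products) in $x_1,\ldots,x_n$, and $<$ is a fixed term order on $\mathcal{T}$. For a nonzero polynomial $P$ over a commutative ring, $\operatorname{lt}(P)$ is the largest term occurring in $P$ with nonzero coefficient. For $\mathfrak{p}\in\operatorname{Spec}(A)$, $k(\mathfrak{p})=A_\mathfrak{p}/\mathfrak{p}A_\mathfrak{p}$, $\sigma_\mathfrak{p}:A[x]\to k(\mathfrak{p})[x]$ is the coefficientwise extension of $A\to k(\mathfrak{p})$, and $\langle\sigma_\mathfrak{p}(I)\rangle$ is the ideal generated by $\sigma_\mathfrak{p}(I)$. A locally closed subset $Y$ of $\operatorname{Spec}(A)$ carries the induced reduced subscheme structure $\mathcal{O}_Y$. Let $\mathfrak{a}\subset A$ be the radical ideal with $\overline{Y}=V(\mathfrak{a})$, identify $\operatorname{Spec}(A/\mathfrak{a})$ with $V(\mathfrak{a})$, and let $\overline{I}$ be the extension of $I$ in $(A/\mathfrak{a})[x]$. Define $\mathcal{I}_Y$ as the restriction to $Y$ of the quasi-coherent sheaf on $\operatorname{Spec}(A/\mathfrak{a})$ associated to the $A/\mathfrak{a}$-module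 $\overline{I}$. Then $\mathcal{I}_Y(Y)$ is regarded as an ideal of $\mathcal{O}_Y(Y)[x]$. For $g\in\mathcal{I}_Y(Y)$ and $\mathfrak{p}\in Y$, $\overline{g}^{\mathfrak{p}}\in\langle\sigma_\mathfrak{p}(I)\rangle$ denotes the image of $g$ under the coefficientwise map $\mathcal{O}_Y(Y)[x]\to k(\mathfrak{p})[x]$. Parametric: a locally closed $Y\subset\operatorname{Spec}(A)$ is parametric (with respect to $I$ and $<$) if there is a finite subset $G\subset\mathcal{I}_Y(Y)$ such that (1) $\overline{G}^{\mathfrak{p}}=\{\overline{g}^{\mathfrak{p}};\ g\in G\}$ is the reduced Gröbner basis of $\langle\sigma_\mathfrak{p}(I)\rangle$ for every $\mathfrak{p}\in Y$, and (2) for each $g\in G$ the function $\mathfrak{p}\mapsto\operatorname{lt}(\overline{g}^{\mathfrak{p}})$ is constant on $Y$. For nonempty $Y$ such a $G$ is uniquely determined by $Y$; it is denoted $G_Y$ and called the reduced Gröbner basis of $I$ over $Y$. Gröbner cover: for a locally closed subset $L$ of $\operatorname{Spec}(A)$, a Gröbner cover of $L$ is a finite set $\mathcal{G}$ of pairs $(Y,G_Y)$ with $Y\subset\operatorname{Spec}(A)$ parametric, $G_Y$ the reduced Gröbner basis of $I$ over $Y$, and $L=\bigcup_{Y\in\mathcal{G}}Y$ (one writes $Y\in\mathcal{G}$ for $(Y,G_Y)\in\mathcal{G}$). It is irreducible if every $Y\in\mathcal{G}$ is irreducible (irreducible spaces are nonempty). It is locally maximal if for every $Y\in\mathcal{G}$: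 whenever $Y'\subset\operatorname{Spec}(A)$ is parametric with $Y'\subset L$ and $Y\subset Y'\subset\overline{Y}$, then $Y=Y'$. It is small if for every $Y\in\mathcal{G}$, $\overline{Y\smallsetminus\bigcup_{Y'\in\mathcal{G}\smallsetminus\{Y\}}Y'}=\overline{Y}$. *)

(* Defs.v *)
From HB Require Import structures.
From mathcomp Require Import all_boot all_order all_algebra.
From mathcomp Require Import ring.
From mathcomp Require Import mpoly.
From mathcomp Require Import boolp classical_sets functions cardinality.
From mathcomp Require Import topology_structure.

Set Implicit Arguments.
Unset Strict Implicit.
Unset Printing Implicit Defensive.

Import GRing.Theory.

Local Open Scope classical_set_scope.
Local Open Scope ring_scope.
Local Open Scope quotient_scope.

Definition is_ideal (R : comNzRingType) (J : set R) : Prop :=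
  [/\ J 0, forall x y, J x -> J y -> J (x + y) & forall a x, J x -> J (a * x)].

Definition gen_ideal (R : comNzRingType) (S : set R) : set R :=
  smallest (@is_ideal R) S.

Definition noetherian (R : comNzRingType) : Prop :=
  forall J : set R, is_ideal J ->
    exists S : set R, finite_set S /\ J = gen_ideal S.

Definition reduced_ring (R : comNzRingType) : Prop :=
  forall (a : R) (k : nat), a ^+ k = 0 -> a = 0.

(* The library type [prime_idealr R] lives in too large a universe to carry
   [set]s, so that its data are repackaged here; every point is given its
   [prime_idealr] structure back just below. *)
Record Spec (R : comNzRingType) := MkSpec {
  Spec_fun : R -> bool;
  _ : idealr_closed (Spec_fun : {pred R}) /\
      prime_idealr_closed (Spec_fun : {pred R})
}.

Definition Spec_pred (R : comNzRingType) (p : Spec R) : {pred R} := Spec_fun p.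
Coercion Spec_pred : Spec >-> pred_sort.

Section SpecIdeal.
Variables (R : comNzRingType) (p : Spec R).
Lemma Spec_idealr_closed : idealr_closed p. Proof. by case: p => ? []. Qed.
Lemma Spec_prime_closed : prime_idealr_closed p. Proof. by case: p => ? []. Qed.
HB.instance Definition _ := isIdealr.Build R (Spec_pred p) Spec_idealr_closed.
HB.instance Definition _ :=
  isPrimeIdealrClosed.Build R (Spec_pred p) Spec_prime_closed.
End SpecIdeal.

HB.instance Definition _ (R : comNzRingType) := gen_eqMixin (Spec R).
HB.instance Definition _ (R : comNzRingType) := gen_choiceMixin (Spec R).

Definition zeros (R : comNzRingType) (S : set R) : set (Spec R) :=
  [set p : Spec R | forall a, S a -> a \in p].

Section Zariski.
Variable R : comNzRingType.

Definition zariski_open (U : set (Spec R)) : Prop :=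
  exists S : set R, ~` U = zeros S.

Lemma zariski_openT : zariski_open setT.
Proof.
exists setT; rewrite setCT; apply/seteqP; split=> // p /(_ 1 I).
by rewrite idealr1.
Qed.

Lemma zariski_openI : setI_closed zariski_open.
Proof.
move=> U V [S US] [T VT].
exists [set c | exists a b, [/\ S a, T b & c = a * b]].
rewrite setCI US VT; apply/seteqP; split=> p.
  move=> [h|h] c [a [b [Sa Tb ->]]]; rewrite prime_idealrM.
    by rewrite (h _ Sa).
  by rewrite (h _ Tb) orbT.
move=> h; rewrite /setU /mkset.
case: (EM (zeros S p)) => [|/existsNP[a]]; first by left.
move=> /not_implyP[Sa /negP/negbTE pa]; right=> b Tb.
have /h : exists a0 b0, [/\ S a0, T b0 & a * b = a0 * b0] by exists a, b.
by rewrite prime_idealrM pa.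
Qed.

Lemma zariski_open_bigU (J : Type) (f : J -> set (Spec R)) :
  (forall i, zariski_open (f i)) -> zariski_open (\bigcup_i f i).
Proof.
move=> /choice[S fS]; exists (\bigcup_i S i).
rewrite setC_bigcup; apply/seteqP; split=> p h.
  by move=> a [i _ Sa]; move: (h i I); rewrite fS; apply.
by move=> i _; rewrite fS => a Sa; apply: h; exists i.
Qed.

HB.instance Definition _ := isOpenTopological.Build (Spec R)
  zariski_openT zariski_openI zariski_open_bigU.

End Zariski.

Definition locally_closed (T : topologicalType) (Y : set T) : Prop :=
  exists U F : set T, [/\ open U, closed F & Y = U `&` F].

Definition irreducible (T : topologicalType) (Y : set T) : Prop :=
  Y !=set0 /\
  forall F1 F2 : set T, closed F1 -> closed F2 ->
    Y `<=` F1 `|` F2 -> Y `<=` F1 \/ Y `<=` F2.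

Section Localization.
Variables (R : comNzRingType) (p : Spec R).

Definition frac : Type := {x : R * R | x.2 \notin p}.
HB.instance Definition _ := Choice.on frac.

Lemma frac_den (x : frac) : (val x).2 \in p = false.
Proof. exact/negbTE/(valP x). Qed.

Definition eqfrac (x y : frac) : bool :=
  `[< exists2 u, u \notin p &
        u * ((val x).1 * (val y).2) = u * ((val y).1 * (val x).2) >].

Lemma eqfrac_equiv : equiv_class_of eqfrac.
Proof.
split=> [x|x y|y x z].
- by apply/asboolP; exists 1; rewrite ?idealr1.
- by apply/asboolP/asboolP => -[u pu e]; exists u.
move=> /asboolP[u pu e1] /asboolP[v pv e2]; apply/asboolP.
exists (u * v * (val y).2).
  by rewrite !prime_idealrM (negbTE pu) (negbTE pv) frac_den.
rewrite [LHS](_ : _ = v * (val z).2 * (u * ((val x).1 * (val y).2))); last by ring.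
rewrite e1 [RHS](_ : _ = u * (val x).2 * (v * ((val z).1 * (val y).2))); last by ring.
by rewrite -e2; ring.
Qed.

Canonical eqfrac_equivRel := EquivRelPack eqfrac_equiv.

Definition loc : Type := {eq_quot eqfrac}.
HB.instance Definition _ := Choice.on loc.
HB.instance Definition _ : EqQuotient frac eqfrac loc := EqQuotient.on loc.

Definition mkfrac (a f : R) (hf : f \notin p) : loc :=
  \pi_loc (exist (fun x : R * R => x.2 \notin p) (a, f) hf).

Lemma mkfracP (a b f g : R) (hf : f \notin p) (hg : g \notin p) :
  mkfrac a hf = mkfrac b hg <->
  exists2 u, u \notin p & u * (a * g) = u * (b * f).
Proof.
split=> [/eqmodP/asboolP//|h]; exact/eqmodP/asboolP.
Qed.

Lemma loc_ind (P : loc -> Prop) :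
  (forall a f (hf : f \notin p), P (mkfrac a hf)) -> forall x, P x.
Proof. by move=> h x; rewrite -[x]reprK; case: (repr x) => -[a f] hf; apply: h. Qed.

Lemma notin_prime1 : 1 \notin p. Proof. by rewrite idealr1. Qed.

Lemma notin_primeM f g : f \notin p -> g \notin p -> f * g \notin p.
Proof. by move=> /negbTE hf /negbTE hg; rewrite prime_idealrM hf hg. Qed.

Definition loc_num (x : loc) : R := (val (repr x)).1.
Definition loc_den (x : loc) : R := (val (repr x)).2.
Lemma loc_den_notin x : loc_den x \notin p. Proof. exact: valP (repr x). Qed.

Lemma loc_fracE x : x = mkfrac (loc_num x) (loc_den_notin x).
Proof.
rewrite -[LHS]reprK /mkfrac; congr (\pi_loc _).
by apply: val_inj; rewrite /= /loc_num /loc_den -surjective_pairing.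
Qed.

Lemma loc_num_denP a f (hf : f \notin p) :
  exists2 u, u \notin p & u * (loc_num (mkfrac a hf) * f) = u * (a * loc_den (mkfrac a hf)).
Proof. by apply/(mkfracP _ _ (loc_den_notin _) hf); rewrite -loc_fracE. Qed.

Definition loc_add (x y : loc) : loc :=
  mkfrac (loc_num x * loc_den y + loc_num y * loc_den x)
         (notin_primeM (loc_den_notin x) (loc_den_notin y)).
Definition loc_opp (x : loc) : loc := mkfrac (- loc_num x) (loc_den_notin x).
Definition loc_mul (x y : loc) : loc :=
  mkfrac (loc_num x * loc_num y) (notin_primeM (loc_den_notin x) (loc_den_notin y)).

Lemma mkfracD a b f g (hf : f \notin p) (hg : g \notin p) :
  loc_add (mkfrac a hf) (mkfrac b hg) =
  mkfrac (a * g + b * f) (notin_primeM hf hg).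
Proof.
apply/mkfracP; have [u pu e] := loc_num_denP a hf; have [v pv e'] := loc_num_denP b hg.
exists (u * v); first exact: notin_primeM.
move: (loc_num _) (loc_den _) (loc_num (mkfrac b hg)) (loc_den (mkfrac b hg))
  e e' => x y z t e e'.
rewrite [LHS](_ : _ = (u * (x * f)) * (v * t * g) + (v * (z * g)) * (u * y * f)); last by ring.
by rewrite e e'; ring.
Qed.

Lemma mkfracN a f (hf : f \notin p) : loc_opp (mkfrac a hf) = mkfrac (- a) hf.
Proof.
apply/mkfracP; have [u pu e] := loc_num_denP a hf; exists u => //.
by rewrite !mulNr !mulrN e.
Qed.

Lemma mkfracM a b f g (hf : f \notin p) (hg : g \notin p) :
  loc_mul (mkfrac a hf) (mkfrac b hg) = mkfrac (a * b) (notin_primeM hf hg).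
Proof.
apply/mkfracP; have [u pu e] := loc_num_denP a hf; have [v pv e'] := loc_num_denP b hg.
exists (u * v); first exact: notin_primeM.
move: (loc_num _) (loc_den _) (loc_num (mkfrac b hg)) (loc_den (mkfrac b hg))
  e e' => x y z t e e'.
rewrite [LHS](_ : _ = (u * (x * f)) * (v * (z * g))); last by ring.
by rewrite e e'; ring.
Qed.

Lemma mkfrac_eq a b f g (hf : f \notin p) (hg : g \notin p) :
  a * g = b * f -> mkfrac a hf = mkfrac b hg.
Proof. by move=> e; apply/mkfracP; exists 1; rewrite ?idealr1// e. Qed.

Lemma loc_addA : associative loc_add.
Proof.
elim/loc_ind=> a f hf; elim/loc_ind=> b g hg; elim/loc_ind=> c h hh.
by rewrite !mkfracD; apply: mkfrac_eq; ring.
Qed.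
Lemma loc_addC : commutative loc_add.
Proof.
elim/loc_ind=> a f hf; elim/loc_ind=> b g hg.
by rewrite !mkfracD; apply: mkfrac_eq; ring.
Qed.
Lemma loc_add0 : left_id (mkfrac 0 notin_prime1) loc_add.
Proof. by elim/loc_ind=> a f hf; rewrite !mkfracD; apply: mkfrac_eq; ring. Qed.
Lemma loc_addN : left_inverse (mkfrac 0 notin_prime1) loc_opp loc_add.
Proof. by elim/loc_ind=> a f hf; rewrite mkfracN !mkfracD; apply: mkfrac_eq; ring. Qed.

HB.instance Definition _ :=
  GRing.isZmodule.Build loc loc_addA loc_addC loc_add0 loc_addN.

Lemma loc_mulA : associative loc_mul.
Proof.
elim/loc_ind=> a f hf; elim/loc_ind=> b g hg; elim/loc_ind=> c h hh.
by rewrite !mkfracM; apply: mkfrac_eq; ring.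
Qed.
Lemma loc_mulC : commutative loc_mul.
Proof.
elim/loc_ind=> a f hf; elim/loc_ind=> b g hg.
by rewrite !mkfracM; apply: mkfrac_eq; ring.
Qed.
Lemma loc_mul1 : left_id (mkfrac 1 notin_prime1) loc_mul.
Proof. by elim/loc_ind=> a f hf; rewrite !mkfracM; apply: mkfrac_eq; ring. Qed.
Lemma loc_mulDl : left_distributive loc_mul loc_add.
Proof.
elim/loc_ind=> a f hf; elim/loc_ind=> b g hg; elim/loc_ind=> c h hh.
by rewrite !(mkfracD, mkfracM); apply: mkfrac_eq; ring.
Qed.
Lemma loc_1neq0 : mkfrac 1 notin_prime1 != 0.
Proof.
apply/eqP => /mkfracP[u /negP pu]; rewrite mul0r !mulr1 mulr0 => u0.
by apply: pu; rewrite u0 idealr0.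
Qed.

HB.instance Definition _ := GRing.Zmodule_isComNzRing.Build loc
  loc_mulA loc_mulC loc_mul1 loc_mulDl loc_1neq0.

Lemma locD a b f g (hf : f \notin p) (hg : g \notin p) :
  mkfrac a hf + mkfrac b hg = mkfrac (a * g + b * f) (notin_primeM hf hg).
Proof. exact: mkfracD. Qed.
Lemma locN a f (hf : f \notin p) : - mkfrac a hf = mkfrac (- a) hf.
Proof. exact: mkfracN. Qed.
Lemma locM a b f g (hf : f \notin p) (hg : g \notin p) :
  mkfrac a hf * mkfrac b hg = mkfrac (a * b) (notin_primeM hf hg).
Proof. exact: mkfracM. Qed.
Lemma loc1 : 1 = mkfrac 1 notin_prime1 :> loc. Proof. by []. Qed.
Lemma loc0 : 0 = mkfrac 0 notin_prime1 :> loc. Proof. by []. Qed.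

Definition toloc (a : R) : loc := mkfrac a notin_prime1.

Lemma toloc_zmod_morphism : zmod_morphism toloc.
Proof. by move=> a b; rewrite /toloc locN locD; apply: mkfrac_eq; ring. Qed.
HB.instance Definition _ :=
  GRing.isZmodMorphism.Build R loc toloc toloc_zmod_morphism.
Lemma toloc_monoid_morphism : monoid_morphism toloc.
Proof. by split=> // a b; rewrite /toloc locM; apply: mkfrac_eq; ring. Qed.
HB.instance Definition _ :=
  GRing.isMonoidMorphism.Build R loc toloc toloc_monoid_morphism.

(* The ideal $p R_p$ and the residue field $k(p) = R_p / p R_p$. *)
Definition maxid : {pred loc} := fun x =>
  `[< exists a f (hf : f \notin p), a \in p /\ x = mkfrac a hf >].

Lemma mkfrac_maxid a f (hf : f \notin p) : (mkfrac a hf \in maxid) = (a \in p).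
Proof.
apply/asboolP/idP => [[b [g [hg [pb /mkfracP[u pu e]]]]]|pa].
  have : u * (a * g) \in p by rewrite e !prime_idealrM pb orbT.
  by rewrite !prime_idealrM (negbTE pu) (negbTE hg) /= orbF.
by exists a, f, hf.
Qed.

Lemma maxid_idealr : idealr_closed maxid.
Proof.
split; first by rewrite loc0 mkfrac_maxid idealr0.
  by rewrite loc1 mkfrac_maxid idealr1.
elim/loc_ind=> a f hf; elim/loc_ind=> b g hg; elim/loc_ind=> c h hh.
rewrite locM locD !mkfrac_maxid => pb pc.
by rewrite rpredD // mulrC !idealMr.
Qed.
HB.instance Definition _ := isIdealr.Build loc maxid maxid_idealr.

Definition kappa : Type := {ideal_quot maxid}.
HB.instance Definition _ := GRing.ComNzRing.on kappa.

Definition tokappa (x : loc) : kappa := \pi_kappa x.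

Lemma tokappa_zmod_morphism : zmod_morphism tokappa.
Proof. by move=> x y; rewrite /tokappa rmorphB. Qed.
HB.instance Definition _ :=
  GRing.isZmodMorphism.Build loc kappa tokappa tokappa_zmod_morphism.
Lemma tokappa_monoid_morphism : monoid_morphism tokappa.
Proof. by split=> [|x y]; rewrite /tokappa ?rmorph1 ?rmorphM. Qed.
HB.instance Definition _ :=
  GRing.isMonoidMorphism.Build loc kappa tokappa tokappa_monoid_morphism.

Lemma tokappa_eq0 (x : loc) : (tokappa x == 0) = (x \in maxid).
Proof. by rewrite -[x in RHS]subr0 Quotient.idealrBE raddf0. Qed.

Lemma kappa_has_inv (x : kappa) : x != 0 -> exists y : kappa, y * x = 1.
Proof.
rewrite -[x]reprK -/(tokappa _) tokappa_eq0; elim/loc_ind: (repr x) => a f hf.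
rewrite mkfrac_maxid => pa; exists (tokappa (mkfrac f pa)).
rewrite -rmorphM locM -(rmorph1 tokappa) loc1.
by congr tokappa; apply: mkfrac_eq; ring.
Qed.

Definition kappa_inv (x : kappa) : kappa :=
  if pselect (exists y, y * x = 1) is left e then projT1 (cid e) else 0.

Lemma kappa_mulVf (x : kappa) : x != 0 -> kappa_inv x * x = 1.
Proof.
move=> /kappa_has_inv e; rewrite /kappa_inv.
by case: pselect => // e'; exact: (projT2 (cid e')).
Qed.

Lemma kappa_inv0 : kappa_inv 0 = 0.
Proof.
rewrite /kappa_inv; case: pselect => // e; have [y] := e; move=> /eqP.
by rewrite mulr0 eq_sym oner_eq0.
Qed.

HB.instance Definition _ :=
  GRing.ComNzRing_isField.Build kappa kappa_mulVf kappa_inv0.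

Definition res (a : R) : kappa := tokappa (toloc a).

Lemma res_zmod_morphism : zmod_morphism res.
Proof. by move=> a b; rewrite /res !rmorphB. Qed.
HB.instance Definition _ :=
  GRing.isZmodMorphism.Build R kappa res res_zmod_morphism.
Lemma res_monoid_morphism : monoid_morphism res.
Proof. by split=> [|a b]; rewrite /res ?rmorph1 ?rmorphM. Qed.
HB.instance Definition _ :=
  GRing.isMonoidMorphism.Build R kappa res res_monoid_morphism.

Lemma res_eq0 a : (res a == 0) = (a \in p).
Proof. by rewrite tokappa_eq0 mkfrac_maxid. Qed.
End Localization.

(* Nonempty locally closed subsets: nonemptiness makes $A/a$ and $O_Y(Y)$ nonzero,
   so that they are [comNzRingType]s and {mpoly _[n]} applies to them. *)
Record lcset (A : comNzRingType) := MkLcset {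
  lccar :> set (Spec A);
  lccar_lc : locally_closed lccar;
  lccar_n0 : lccar !=set0
}.

Section ReducedStructure.
Variables (A : comNzRingType) (Y : lcset A).

(* The radical ideal $a$ with $V(a) = \overline Y$, see [zeros_vanish]. *)
Definition vanish : {pred A} := fun a => `[< forall p, lccar Y p -> a \in p >].

Lemma vanish_idealr : idealr_closed vanish.
Proof.
split.
- by apply/asboolP => p _; rewrite idealr0.
- have [p Yp] := lccar_n0 Y.
  by apply/negP => /asboolP /(_ p Yp); rewrite idealr1.
- move=> a u v /asboolP hu /asboolP hv; apply/asboolP => p Yp.
  by rewrite rpredD ?idealMr ?hu ?hv.
Qed.
HB.instance Definition _ := isIdealr.Build A vanish vanish_idealr.

Lemma zeros_vanish : zeros [set a | a \in vanish] = closure (Y : set (Spec A)).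
Proof.
rewrite closureE; apply/seteqP; split=> p.
  move=> h F [/closed_openC[S]]; rewrite setCK => -> YF a Sa.
  by apply: h; apply/asboolP => q /YF; apply.
apply; split.
  by rewrite -openC; exists [set a | a \in vanish]; rewrite setCK.
by move=> q Yq a /asboolP; apply.
Qed.

Definition Abar : Type := {ideal_quot vanish}.
HB.instance Definition _ := GRing.ComNzRing.on Abar.

Definition tobar (a : A) : Abar := \pi_Abar a.

Lemma tobar_zmod_morphism : zmod_morphism tobar.
Proof. by move=> x y; rewrite /tobar rmorphB. Qed.
HB.instance Definition _ :=
  GRing.isZmodMorphism.Build A Abar tobar tobar_zmod_morphism.
Lemma tobar_monoid_morphism : monoid_morphism tobar.
Proof. by split=> [|x y]; rewrite /tobar ?rmorph1 ?rmorphM. Qed.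
HB.instance Definition _ :=
  GRing.isMonoidMorphism.Build A Abar tobar tobar_monoid_morphism.

Lemma tobarK (b : Abar) : tobar (repr b) = b. Proof. exact: reprK. Qed.

Lemma repr_tobar (a : A) : repr (tobar a) - a \in vanish.
Proof. by rewrite Quotient.idealrBE reprK. Qed.

Definition lcpt : Type := {p : Spec A | lccar Y p}.

(* The prime ideal $p/a$ of $A/a$, for $p \in Y \subset V(a)$. *)
Definition barp_pred (y : lcpt) : {pred Abar} := fun b => repr b \in sval y.

Lemma barp_pi (y : lcpt) (a : A) :
  (tobar a \in barp_pred y) = (a \in sval y).
Proof.
have /asboolP/(_ _ (svalP y)) e := repr_tobar a.
rewrite -[a in RHS](subKr (repr (tobar a))) rpredBr //.
Qed.

Lemma barp_closed (y : lcpt) :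
  idealr_closed (barp_pred y) /\ prime_idealr_closed (barp_pred y).
Proof.
split; first split.
- by rewrite -(rmorph0 tobar) barp_pi idealr0.
- by rewrite -(rmorph1 tobar) barp_pi idealr1.
- move=> a u v; rewrite -[a]tobarK -[u]tobarK -[v]tobarK -rmorphM -rmorphD !barp_pi.
  by move=> hu hv; rewrite rpredD // idealMr.
by move=> u v; rewrite -[u]tobarK -[v]tobarK -rmorphM !barp_pi prime_idealrM.
Qed.

Definition barp (y : lcpt) : Spec Abar := @MkSpec Abar (barp_pred y) (barp_closed y).

(* $O_{Y,p} = (A/a)_{p/a}$ *)
Definition stalk (y : lcpt) : Type := loc (barp y).
HB.instance Definition _ y := GRing.ComNzRing.on (stalk y).

(* The functions in $O_Y(Y)$. [Spec (A/a)] being identified with $V(a)$, the open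
   subsets of $Y$ are the traces of the open subsets of [Spec A]. *)
Definition regular (s : forall y, stalk y) : Prop :=
  forall y : lcpt, exists U : set (Spec A), [/\ open U, U (sval y) &
    exists b f : Abar, forall z : lcpt, U (sval z) ->
      exists hf : f \notin barp z, s z = mkfrac b hf].

Record OY := MkOY { OY_fun :> forall y, stalk y; OYP : regular OY_fun }.

HB.instance Definition _ := gen_eqMixin OY.
HB.instance Definition _ := gen_choiceMixin OY.

Lemma OY_eq (s t : OY) : (forall y, s y = t y) -> s = t.
Proof.
case: s t => s sP [t tP] /= e.
have {}e : s = t by apply: functional_extensionality_dep.
by subst t; congr MkOY; apply: Prop_irrelevance.
Qed.

Lemma regular_cst (b : Abar) : regular (fun y => toloc (barp y) b).
Proof.
move=> y; exists setT; split; [exact: openT|by []|exists b, 1 => z _].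
by exists (notin_prime1 _).
Qed.

Lemma regular_opp (s : OY) : regular (fun y => - s y).
Proof.
move=> y; have [U [oU Uy [b [f h]]]] := OYP s y.
exists U; split=> //; exists (- b), f => z /h[hf ->]; exists hf.
exact: locN.
Qed.

Lemma regular_add (s t : OY) : regular (fun y => s y + t y).
Proof.
move=> y; have [U [oU Uy [b [f h]]]] := OYP s y.
have [V [oV Vy [c [g k]]]] := OYP t y.
exists (U `&` V); split; [exact: openI|by []|exists (b * g + c * f), (f * g)].
move=> z [/h[hf ->] /k[hg ->]]; exists (notin_primeM hf hg); exact: locD.
Qed.

Lemma regular_mul (s t : OY) : regular (fun y => s y * t y).
Proof.
move=> y; have [U [oU Uy [b [f h]]]] := OYP s y.
have [V [oV Vy [c [g k]]]] := OYP t y.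
exists (U `&` V); split; [exact: openI|by []|exists (b * c), (f * g)].
move=> z [/h[hf ->] /k[hg ->]]; exists (notin_primeM hf hg); exact: locM.
Qed.

Definition OY_cst b : OY := MkOY (regular_cst b).
Definition OY_opp s : OY := MkOY (regular_opp s).
Definition OY_add s t : OY := MkOY (regular_add s t).
Definition OY_mul s t : OY := MkOY (regular_mul s t).

Lemma OY_addA : associative OY_add.
Proof. by move=> s t u; apply: OY_eq => y /=; rewrite addrA. Qed.
Lemma OY_addC : commutative OY_add.
Proof. by move=> s t; apply: OY_eq => y /=; rewrite addrC. Qed.
Lemma OY_add0 : left_id (OY_cst 0) OY_add.
Proof. by move=> s; apply: OY_eq => y /=; rewrite rmorph0 add0r. Qed.
Lemma OY_addN : left_inverse (OY_cst 0) OY_opp OY_add.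
Proof. by move=> s; apply: OY_eq => y /=; rewrite rmorph0 addNr. Qed.
HB.instance Definition _ :=
  GRing.isZmodule.Build OY OY_addA OY_addC OY_add0 OY_addN.

Lemma OY_mulA : associative OY_mul.
Proof. by move=> s t u; apply: OY_eq => y /=; rewrite mulrA. Qed.
Lemma OY_mulC : commutative OY_mul.
Proof. by move=> s t; apply: OY_eq => y /=; rewrite mulrC. Qed.
Lemma OY_mul1 : left_id (OY_cst 1) OY_mul.
Proof. by move=> s; apply: OY_eq => y /=; rewrite rmorph1 mul1r. Qed.
Lemma OY_mulDl : left_distributive OY_mul OY_add.
Proof. by move=> s t u; apply: OY_eq => y /=; rewrite mulrDl. Qed.
Lemma OY_1neq0 : OY_cst 1 != 0.
Proof.
have [p Yp] := lccar_n0 Y; apply/eqP => /(congr1 (fun s : OY => s (exist _ p Yp : lcpt))).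
by move=> /eqP; rewrite /= rmorph1 rmorph0 oner_eq0.
Qed.
HB.instance Definition _ := GRing.Zmodule_isComNzRing.Build OY
  OY_mulA OY_mulC OY_mul1 OY_mulDl OY_1neq0.

Definition germ (y : lcpt) (s : OY) : stalk y := s y.

Lemma germ_zmod_morphism y : zmod_morphism (germ y).
Proof. by []. Qed.
HB.instance Definition _ y :=
  GRing.isZmodMorphism.Build OY (stalk y) (germ y) (germ_zmod_morphism y).
Lemma germ_monoid_morphism y : monoid_morphism (germ y).
Proof. by []. Qed.
HB.instance Definition _ y :=
  GRing.isMonoidMorphism.Build OY (stalk y) (germ y) (germ_monoid_morphism y).

(* [res] factors through $A/a$, and then through the stalk: the residue field
   of $A/a$ at $p/a$ is identified with $k(p)$. *)
Definition resbar (y : lcpt) (b : Abar) : kappa (sval y) :=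
  res (sval y) (repr b).

Lemma resbar_tobar (y : lcpt) a : resbar y (tobar a) = res (sval y) a.
Proof.
apply/eqP; rewrite -subr_eq0 -rmorphB res_eq0.
by have /asboolP/(_ _ (svalP y)) := repr_tobar a.
Qed.

Lemma resbar_zmod_morphism y : zmod_morphism (resbar y).
Proof.
move=> b c; rewrite -[b]tobarK -[c]tobarK -rmorphB !resbar_tobar.
exact: rmorphB.
Qed.
HB.instance Definition _ y :=
  GRing.isZmodMorphism.Build Abar (kappa (sval y)) (resbar y)
    (resbar_zmod_morphism y).
Lemma resbar_monoid_morphism y : monoid_morphism (resbar y).
Proof.
split; first by rewrite -(rmorph1 tobar) resbar_tobar rmorph1.
move=> b c; rewrite -[b]tobarK -[c]tobarK -rmorphM !resbar_tobar.
exact: rmorphM.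
Qed.
HB.instance Definition _ y :=
  GRing.isMonoidMorphism.Build Abar (kappa (sval y)) (resbar y)
    (resbar_monoid_morphism y).

Lemma resbar_neq0 y (f : Abar) : f \notin barp y -> resbar y f != 0.
Proof. by rewrite res_eq0. Qed.

Definition stalk_res (y : lcpt) (x : stalk y) : kappa (sval y) :=
  resbar y (loc_num x) / resbar y (loc_den x).

Lemma stalk_res_frac (y : lcpt) (a f : Abar) (hf : f \notin barp y) :
  stalk_res (mkfrac a hf) = resbar y a / resbar y f.
Proof.
rewrite /stalk_res; have [u hu] := loc_num_denP a hf.
move=> /(congr1 (resbar y)); rewrite !rmorphM.
move=> /(mulfI (resbar_neq0 hu)) e.
by apply/eqP; rewrite eqr_div ?resbar_neq0 ?loc_den_notin //; apply/eqP.
Qed.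

Lemma stalk_res_zmod_morphism y : zmod_morphism (@stalk_res y).
Proof.
elim/loc_ind=> a f hf; elim/loc_ind=> b g hg.
rewrite locN locD !stalk_res_frac rmorphD !rmorphM rmorphN -[in RHS]mulNr.
by rewrite addf_div ?resbar_neq0.
Qed.
HB.instance Definition _ y :=
  GRing.isZmodMorphism.Build (stalk y) (kappa (sval y)) (@stalk_res y)
    (@stalk_res_zmod_morphism y).
Lemma stalk_res_monoid_morphism y : monoid_morphism (@stalk_res y).
Proof.
split; first by rewrite loc1 stalk_res_frac rmorph1 divr1.
elim/loc_ind=> a f hf; elim/loc_ind=> b g hg.
by rewrite locM !stalk_res_frac !rmorphM mulf_div.
Qed.
HB.instance Definition _ y :=
  GRing.isMonoidMorphism.Build (stalk y) (kappa (sval y)) (@stalk_res y)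
    (@stalk_res_monoid_morphism y).

Definition eval_at (y : lcpt) (s : OY) : kappa (sval y) := stalk_res (germ y s).

Lemma eval_at_zmod_morphism y : zmod_morphism (eval_at y).
Proof. by move=> s t; rewrite /eval_at !rmorphB. Qed.
HB.instance Definition _ y :=
  GRing.isZmodMorphism.Build OY (kappa (sval y)) (eval_at y)
    (eval_at_zmod_morphism y).
Lemma eval_at_monoid_morphism y : monoid_morphism (eval_at y).
Proof. by split=> [|s t]; rewrite /eval_at ?rmorph1 ?rmorphM. Qed.
HB.instance Definition _ y :=
  GRing.isMonoidMorphism.Build OY (kappa (sval y)) (eval_at y)
    (eval_at_monoid_morphism y).

Section IdealSheaf.
Variables (n : nat) (I : set {mpoly A[n]}).

Definition Ibar : set {mpoly Abar[n]} := gen_ideal (map_mpoly tobar @` I).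

(* The sections over $Y$ of the sheaf associated to $\overline I$: at each point
   of $Y$ they take values in $\overline I_p \subset (A/a)_p[x]$, and locally they
   are of the form $P/f$ with $P \in \overline I$ and $f \in A/a$. *)
Definition IY : set {mpoly OY[n]} :=
  [set g | forall y : lcpt, exists U : set (Spec A), [/\ open U, U (sval y) &
    exists2 P : {mpoly Abar[n]}, Ibar P &
    exists f : Abar, forall z : lcpt, U (sval z) ->
      exists hf : f \notin barp z,
        map_mpoly (germ z) g = mkfrac 1 hf *: map_mpoly (toloc (barp z)) P]].
End IdealSheaf.

End ReducedStructure.

Arguments IY {A} Y {n} I.

(* [le] is the reflexive closure of the term order; the monomial [0%MM] is the
   term $1$ and [+%MM] is the product of terms. *)
Definition term_order (n : nat) (le : rel 'X_{1..n}) : Prop :=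
  [/\ total le, antisymmetric le, transitive le,
      forall t, le 0%MM t &
      forall t t1 t2, le t1 t2 -> le (t + t1)%MM (t + t2)%MM].

Section GroebnerBasis.
Variables (n : nat) (le : rel 'X_{1..n}).

Definition max_term (t1 t2 : 'X_{1..n}) : 'X_{1..n} :=
  if le t1 t2 then t2 else t1.

(* The leading term, with the junk value $1$ at the zero polynomial. *)
Definition lterm (R : nzRingType) (P : {mpoly R[n]}) : 'X_{1..n} :=
  \big[max_term/0%MM]_(t <- msupp P) t.

Variable K : fieldType.

Definition lead_ideal (S : set {mpoly K[n]}) : set {mpoly K[n]} :=
  gen_ideal [set 'X_[lterm P] | P in [set P | S P /\ P != 0]].

Definition groebner_basis (J G : set {mpoly K[n]}) : Prop :=
  [/\ finite_set G, G `<=` J & lead_ideal G = lead_ideal J].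

Definition reduced_groebner_basis (J G : set {mpoly K[n]}) : Prop :=
  groebner_basis J G /\
  forall g, G g -> g@_(lterm g) = 1 /\
    forall t, t \in msupp g -> ~ lead_ideal (G `\ g) 'X_[t].

End GroebnerBasis.

Section GroebnerCover.
Variables (A : comNzRingType) (n : nat) (le : rel 'X_{1..n}).
Variable I : set {mpoly A[n]}.

(* [G] is the reduced Groebner basis $G_Y$ of $I$ over $Y$. *)
Definition is_GY (Y : lcset A) (G : set {mpoly (OY Y)[n]}) : Prop :=
  [/\ finite_set G, G `<=` IY Y I,
      forall y : lcpt Y,
        reduced_groebner_basis le
          (gen_ideal (map_mpoly (res (sval y)) @` I))
          (map_mpoly (eval_at y) @` G) &
      forall g, G g -> forall y z : lcpt Y,
        lterm le (map_mpoly (eval_at y) g) = lterm le (map_mpoly (eval_at z) g)].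

Definition parametric (Y : lcset A) : Prop := exists G, is_GY (Y := Y) G.

Definition piece : Type := {Y : lcset A & set {mpoly (OY Y)[n]}}.
Definition piece_set (c : piece) : lcset A := projT1 c.

Definition groebner_cover (L : set (Spec A)) (C : set piece) : Prop :=
  [/\ finite_set C, forall c, C c -> is_GY (projT2 c) &
      L = \bigcup_(c in C) piece_set c].

Definition irreducible_cover (C : set piece) : Prop :=
  forall c, C c -> irreducible (piece_set c : set (Spec A)).

Definition small_cover (C : set piece) : Prop :=
  forall c, C c ->
    closure (piece_set c `\` \bigcup_(c' in C `\ c) piece_set c') =
    closure (piece_set c : set (Spec A)).

Definition locally_maximal_cover (L : set (Spec A)) (C : set piece) : Prop :=
  forall c, C c -> forall Y' : lcset A, parametric Y' ->
    Y' `<=` L -> piece_set c `<=` Y' ->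
    Y' `<=` closure (piece_set c : set (Spec A)) ->
    (piece_set c : set (Spec A)) = Y'.

End GroebnerCover.

(* Main.v *)
Require Import Defs.
From mathcomp Require Import all_boot all_order all_algebra.
From mathcomp Require Import mpoly.
From mathcomp Require Import boolp classical_sets functions cardinality.
From mathcomp Require Import topology_structure.

(** For a prime [p] let [J_p] be the ideal generated by [I] in [k(p)[x]] and let
    [G_p] be its reduced Groebner basis. An element [g] of [G_p] extends to a
    prime [q] containing [p] when [g] = [P/f] for some [P] in [I] and some [f]
    outside [q]. The stratum [M p] is the set of the [q] in [L] above [p] to which
    the whole of [G_p] extends; it is open in [V(p)] within [L].

    Commutative algebra enters through two facts about [M p], for [p] in [L].

    - [M p] is parametric. If the monic family [G_p] extends to [q], division by
      it is possible with coefficients in the local ring [(A/p)_q], and it never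
      leaves [q (A/p)_q] when it starts there. Hence an element of [J_q] without
      reducible terms lifts to an element of [I] whose remainder vanishes at [p],
      and is therefore zero: the reductions of [G_p] form the reduced Groebner
      basis of [J_q], with unchanged leading terms ([reduced_gb_specialize]). The
      fractions [P/f] glue to sections over [M p] ([extends_parametric]).

    - [M p] contains every parametric [Y] in [L] with [p] in [Y] and [Y] in
      [V(p)]: the value at [p] of the basis of [Y] is [G_p] by uniqueness of
      reduced Groebner bases, and near [q] its members are fractions defined both
      at [q] and at the generization [p] ([parametric_extends]).

    An irreducible locally closed [Y] has a generic point [p] in [Y], so by these
    facts an irreducible parametric [Y] in [L] is locally maximal exactly when it
    equals [M p]. An irreducible locally maximal Groebner cover of [L] is therefore
    the same as a finite set [S] of primes of [L] whose strata cover [L]. A stratum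
    [M q] containing [p] contains a neighbourhood of [p] in [V(p)], because it is
    locally closed; so the cover is small exactly when no [p] in [S] lies in [M q]
    for another [q] in [S].

    What is left is combinatorial: exactly one such [S] exists. For uniqueness, a
    minimal prime [p] of the symmetric difference of [S] and [S'], say with [p] in
    [S], lies in some [M q] with [q] in [S'] strictly below [p]; then [q] is in [S]
    too, and [S] is not irredundant ([irredundant_cover_uniq]). For existence, one
    adds to [S] a generic point of the part of [L] not yet covered, which enlarges
    the vanishing ideal of that part, so the process stops
    ([irredundant_cover_exists]). *)

Set Implicit Arguments.
Unset Strict Implicit.
Unset Printing Implicit Defensive.

Import GRing.Theory.

Local Open Scope classical_set_scope.
Local Open Scope ring_scope.

(** * Term orders *)

(** Dickson's lemma, by induction on the number of exponents that may vary in [E].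
    Once [e] in [E] is chosen, a term of [E] that [e] does not divide has some
    exponent [i] equal to a [v < e i], and fixing it leaves fewer free exponents. *)
Lemma dickson_free n (k : nat) (X : {set 'I_n}) (E : set 'X_{1..n}) :
  (#|X| < k)%N ->
  (forall t u, E t -> E u -> forall i, i \notin X -> t i = u i) ->
  exists D, [/\ finite_set D, D `<=` E &
    forall t, E t -> exists2 d, D d & (d <= t)%MM].
Proof.
elim: k X E => // k IH X E Xk agree.
have [->|/set0P[e Ee]] := eqVneq E set0.
  by exists set0; split=> //; exact: finite_set0.
have /choice[D HD] (iv : 'I_n * nat) : exists D : set 'X_{1..n},
    iv.1 \in X -> let F := [set t | E t /\ t iv.1 = iv.2] in
    [/\ finite_set D, D `<=` F & forall t, F t -> exists2 d, D d & (d <= t)%MM].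
  case: iv => i v /=; have [iX|_] := boolP (i \in X); last by exists set0.
  have [||D HD] := IH (X :\ i)%SET [set t | E t /\ t i = v]; last by exists D.
    by move: Xk; rewrite (cardsD1 i X) iX.
  move=> t u [Et ti] [Eu ui] j; rewrite in_setD1 negb_and negbK.
  by case: eqP => [->|_ /=]; [rewrite ti ui | exact: agree].
exists ([set e] `|` \bigcup_(i in [set i | i \in X])
          \bigcup_(v in `I_(e i)) D (i, v)); split.
- rewrite finite_setU; split; first exact: finite_set1.
  apply: bigcup_finite => [|i iX]; first exact: finite_finset.
  by apply: bigcup_finite => [|v _]; [exact: finite_II | case: (HD (i, v) iX)].
- move=> t [->//|[i iX [v _ Dt]]].
  by have [_ /(_ _ Dt)[]] := HD (i, v) iX.
- move=> t Et; have [et|/mnm_lepP net] := boolP (e <= t)%MM.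
    by exists e => //; left.
  have /existsNP[i /negP] := net; rewrite -ltnNge => ti.
  have iX : i \in X.
    by apply: contraTT ti => iX; rewrite (agree e t) // ltnn.
  have [_ _ /(_ t)[//|d Dd dt]] := HD (i, t i) iX.
  by exists d => //; right; exists i => //; exists (t i).
Qed.

Lemma dickson n (E : set 'X_{1..n}) :
  exists D, [/\ finite_set D, D `<=` E &
    forall t, E t -> exists2 d, D d & (d <= t)%MM].
Proof.
apply: (@dickson_free n #|[set: 'I_n]%SET|.+1 [set: 'I_n]%SET) => // t u _ _ i.
by rewrite inE.
Qed.

Section TermOrder.
Variables (n : nat) (le : rel 'X_{1..n}).
Hypothesis leT : term_order le.

Lemma le_refl t : le t t.
Proof. by case: leT => tot *; have := tot t t; rewrite orbb. Qed.

Lemma le_tr t u v : le t u -> le u v -> le t v.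
Proof. by case: leT => _ _ tr _ _; exact: tr. Qed.

Lemma le_anti t u : le t u -> le u t -> t = u.
Proof. by case: leT => _ anti _ _ _ tu ut; apply: anti; rewrite tu ut. Qed.

Lemma nle_le t u : ~~ le t u -> le u t.
Proof. by case: leT => tot _ _ _ _; have := tot t u; case: (le t u). Qed.

Lemma lepm_le t u : (t <= u)%MM -> le t u.
Proof.
case: leT => _ _ _ le0 leD tu.
by rewrite -(submK tu) addmC -[X in le X _]addm0; apply: leD.
Qed.

(** A finite divisibility basis suffices, since divisors are smaller for [le]. *)
Lemma le_min (E : set 'X_{1..n}) : E !=set0 ->
  exists2 t, E t & forall u, E u -> le t u.
Proof.
move=> [e Ee]; have [D [/finite_seqP[s ->] DE DB]] := dickson E.
have {e Ee} : s != [::].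
  by have [d] := DB _ Ee; case: s {DE DB}.
move=> s0; have [t ts tmin] : exists2 t, t \in s & forall u, u \in s -> le t u.
  elim: s s0 {DE DB} => // a s IH _; have [->|/IH[t ts tm]] := eqVneq s [::].
    by exists a; rewrite ?mem_head// => u; rewrite inE => /eqP->; exact: le_refl.
  have [ta|/nle_le at_] := boolP (le t a).
    exists t; first by rewrite inE ts orbT.
    by move=> u; rewrite inE => /orP[/eqP->|/tm].
  exists a; rewrite ?mem_head// => u; rewrite inE => /orP[/eqP->|/tm].
    exact: le_refl.
  exact: le_tr.
exists t; first exact: DE.
by move=> u /DB[d /tmin td /lepm_le du]; exact: le_tr du.
Qed.

Lemma le_wf (P : 'X_{1..n} -> Prop) :
  (forall t, (forall u, le u t -> u != t -> P u) -> P t) -> forall t, P t.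
Proof.
move=> IH t; apply: contrapT => nPt.
have [|u nPu umin] := @le_min [set u | ~ P u]; first by exists t.
apply: nPu; apply: IH => v vu /eqP neq; apply: contrapT => nPv.
by apply: neq; apply: le_anti => //; exact: umin.
Qed.

Lemma bigmax_ge (s : seq 'X_{1..n}) t :
  t \in s -> le t (\big[max_term le/0%MM]_(u <- s) u).
Proof.
elim: s => // a s IH; rewrite big_cons /max_term inE.
case: ifP => [am|/negbT/nle_le ma] /orP[/eqP->|/IH ts] //; first exact: le_refl.
exact: le_tr ma.
Qed.

Lemma bigmax_mem (s : seq 'X_{1..n}) :
  s != [::] -> \big[max_term le/0%MM]_(u <- s) u \in s.
Proof.
elim: s => // a s IH _; rewrite big_cons /max_term.
have [->|/IH ms] := eqVneq s [::].
  rewrite big_nil; case: ifP => [a0|]; last by rewrite mem_head.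
  by rewrite (@le_anti a 0%MM) ?mem_head//; case: leT.
by case: ifP; rewrite inE ?eqxx// ms orbT.
Qed.

Section LeadingTerm.
Variable R : nzRingType.
Implicit Types P Q : {mpoly R[n]}.

Lemma lterm_ge P t : t \in msupp P -> le t (lterm le P).
Proof. exact: bigmax_ge. Qed.

Lemma lterm_supp P : P != 0 -> lterm le P \in msupp P.
Proof. by rewrite -msupp_eq0; exact: bigmax_mem. Qed.

Lemma lterm_eq P t :
  t \in msupp P -> (forall u, u \in msupp P -> le u t) -> lterm le P = t.
Proof.
move=> tP tmax; apply: le_anti; last exact: lterm_ge.
apply/tmax/lterm_supp; apply: contraTneq tP => ->.
by rewrite msupp0.
Qed.

End LeadingTerm.
End TermOrder.

(** * Reduced Groebner bases over a field *)

Section Ideals.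
Variable R : comNzRingType.
Implicit Types (S : set R) (J : set R).

Lemma gen_ideal_ideal S : is_ideal (gen_ideal S).
Proof.
split=> [K []|x y Sx Sy K KS|a x Sx K KS]; first by case.
  by have [[_ D _] _] := KS; apply: D; [exact: (Sx K) | exact: (Sy K)].
by have [[_ _ M] _] := KS; apply: M; exact: (Sx K).
Qed.

Lemma sub_gen_ideal S : S `<=` gen_ideal S.
Proof. exact: sub_gen_smallest. Qed.

Lemma gen_ideal_min S J : is_ideal J -> S `<=` J -> gen_ideal S `<=` J.
Proof. exact: smallest_sub. Qed.

Lemma ideal_opp J x : is_ideal J -> J x -> J (- x).
Proof. by case=> _ _ JM Jx; rewrite -mulN1r; exact: JM. Qed.

Lemma ideal_sub J x y : is_ideal J -> J x -> J y -> J (x - y).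
Proof. by move=> iJ Jx Jy; have [_ JD _] := iJ; apply: JD => //; exact: ideal_opp. Qed.

End Ideals.

Lemma ideal_scale (R : comNzRingType) n (J : set {mpoly R[n]}) c P :
  is_ideal J -> J P -> J (c *: P).
Proof. by case=> _ _ JM JP; rewrite -mul_mpolyC; exact: JM. Qed.

Lemma mcoeffXM (R : comNzRingType) n (P : {mpoly R[n]}) s t :
  ('X_[s] * P)@_t = if (s <= t)%MM then P@_(t - s) else 0.
Proof.
rewrite mulrC; case: ifP => [st|nst].
  by rewrite -[in LHS](submK st) addmC mcoeffMX.
apply/memN_msupp_eq0; rewrite (perm_mem (msuppMX _ _)).
by apply/mapP=> -[u _ tE]; rewrite tE lem_addr in nst.
Qed.

Section GroebnerTheory.
Variables (n : nat) (le : rel 'X_{1..n}).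
Hypothesis leT : term_order le.

(** The polynomials all of whose terms are divisible by a member of [E] form an
    ideal, so membership in a monomial ideal is divisibility. *)
Lemma monomial_idealP (R : comNzRingType) (E : set 'X_{1..n}) t :
  gen_ideal [set 'X_[R, d] | d in E] 'X_[t] <-> exists2 d, E d & (d <= t)%MM.
Proof.
split=> [Xt|[d Ed dt]]; last first.
  have [_ _ mulJ] := gen_ideal_ideal [set 'X_[R, d] | d in E].
  rewrite -(submK dt) mpolyXD; apply: mulJ; apply: sub_gen_ideal.
  by exists d.
suff: gen_ideal [set 'X_[R, d] | d in E] `<=`
      [set P | forall t, t \in msupp P -> exists2 d, E d & (d <= t)%MM].
  by move=> /(_ _ Xt)/(_ t); apply; rewrite msuppX mem_head.
apply: gen_ideal_min => [|_ [d Ed <-] u]; last first.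
  by rewrite msuppX inE => /eqP->; exists d => //; exact: lepm_refl.
split=> [u|P Q HP HQ u /msuppD_le|P Q HQ u /msuppM_le].
- by rewrite msupp0.
- by rewrite mem_cat => /orP[/HP|/HQ].
- move=> /allpairsP[[a b] /= [_ /HQ[d Ed db] ->]]; exists d => //.
  exact: lepm_trans db (lem_addl _ _).
Qed.

Lemma lead_idealP (K : fieldType) (S : set {mpoly K[n]}) t :
  lead_ideal le S 'X_[t] <->
  exists P, [/\ S P, P != 0 & (lterm le P <= t)%MM].
Proof.
rewrite /lead_ideal (_ : [set _ | _ in _] =
  [set 'X_[K, d] | d in [set lterm le P | P in [set P : {mpoly K[n]} | S P /\ P != 0]]]).
  apply: (iff_trans (monomial_idealP _ _ _)); split.
    by move=> [_ [P [SP P0] <-] Pt]; exists P.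
  by move=> [P [SP P0 Pt]]; exists (lterm le P) => //; exists P.
by rewrite -image_comp.
Qed.

(** These are the terms irreducible for division by [G]. *)
Definition standard (R : nzRingType) (G : set {mpoly R[n]}) (t : 'X_{1..n}) :=
  forall g, G g -> ~~ (lterm le g <= t)%MM.

Lemma nstandardP (R : nzRingType) (G : set {mpoly R[n]}) t :
  ~ standard G t -> exists2 g, G g & (lterm le g <= t)%MM.
Proof.
by move=> /existsNP[g /not_implyP[Gg /negP]]; rewrite negbK; exists g.
Qed.

Lemma max_nonstandard (R : nzRingType) (G : set {mpoly R[n]})
    (f : {mpoly R[n]}) :
  (forall t, t \in msupp f -> standard G t) \/
  exists u, [/\ u \in msupp f, ~ standard G u &
    forall t, t \in msupp f -> ~ standard G t -> le t u].
Proof.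
pose s := [seq t <- msupp f | ~~ `[< standard G t >]].
have sP t : (t \in s) = (t \in msupp f) && ~~ `[< standard G t >].
  by rewrite mem_filter andbC.
have [s0|s0] := eqVneq s [::].
  left=> t tf; apply: contrapT => /asboolPn nt.
  by have := sP t; rewrite tf nt s0.
right; exists (\big[max_term le/0%MM]_(u <- s) u).
have := bigmax_mem leT s0; rewrite sP => /andP[-> /asboolPn]; split=> // t tf.
by move=> /asboolPn nt; apply: bigmax_ge => //; rewrite sP tf.
Qed.

(** Multivariate division by a monic family, over any commutative ring. The set
    [coefs] confines the coefficients used in the quotients, [U] confines the terms
    that are cancelled, and [W] records what [f - r] belongs to. Instances of these
    three give ideal membership, bounds on leading terms, and integrality of the
    quotients over a local subring. *)
Lemma division (R : comNzRingType) (G : set {mpoly R[n]}) (coefs : set R)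
    (U : set 'X_{1..n}) (W : set {mpoly R[n]})
    (f : {mpoly R[n]}) :
  (forall g, G g -> g@_(lterm le g) = 1) ->
  (forall a b g t, coefs a -> coefs b -> G g -> coefs (b - a * g@_t)) ->
  (forall t u, U u -> le t u -> U t) ->
  W 0 -> (forall P Q, W P -> W Q -> W (P + Q)) ->
  (forall a s g, coefs a -> G g -> U (s + lterm le g)%MM ->
    W (a *: ('X_[s] * g))) ->
  (forall t, ~ standard G t -> coefs f@_t) ->
  (forall t, t \in msupp f -> ~ standard G t -> U t) ->
  exists2 r, W (f - r) & forall t, t \in msupp r -> standard G t.
Proof.
move=> G1 coefsG Udown W0 WD WG.
have std h : (forall t, t \in msupp h -> standard G t) ->
    exists2 r, W (h - r) & forall t, t \in msupp r -> standard G t.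
  by move=> hs; exists h => //; rewrite subrr.
move=> coefsf Uf; have [/std//|[u [uf nu fu]]] := max_nonstandard G f.
(* Cancel the largest nonstandard term [u]; the new ones are smaller. *)
elim/(le_wf leT): u => u IH in f coefsf Uf uf nu fu *.
have [g Gg gu] := nstandardP nu.
have [s uE] : exists s, u = (s + lterm le g)%MM.
  by exists (u - lterm le g)%MM; rewrite submK.
pose h := f@_u *: ('X_[s] * g); pose f' := f - h.
have Wh : W h by apply: WG; rewrite -?uE//; [exact: coefsf | exact: Uf].
have f'u : u \notin msupp f'.
  rewrite -mcoeff_eq0 mcoeffB mcoeffZ mcoeffXM uE lem_addr addmC addmK G1//.
  by rewrite mulr1 subrr.
have hu t : t \in msupp h -> le t u.
  move=> /msuppZ_le /msuppM_le /allpairsP[[a b] /= [+ /(lterm_ge leT) bg ->]].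
  rewrite msuppX inE => /eqP->; rewrite uE.
  by case: leT => _ _ _ _ leD; exact: leD.
have f'le t : t \in msupp f' -> ~ standard G t -> le t u.
  by move=> /msuppB_le; rewrite mem_cat => /orP[tf|/hu//] nt; exact: fu.
have coefsf' t : ~ standard G t -> coefs f'@_t.
  move=> nt; rewrite mcoeffB mcoeffZ mcoeffXM.
  by case: ifP => _; [apply: coefsG => // | rewrite mulr0 subr0]; exact: coefsf.
have Uf' t : t \in msupp f' -> ~ standard G t -> U t.
  by move=> tf' nt; apply: (Udown _ u); [exact: Uf | exact: f'le].
suff [r Wr rs] : exists2 r, W (f' - r) & forall t, t \in msupp r -> standard G t.
  by exists r => //; rewrite -[f](subrK h) -/f' addrAC; exact: WD.
have [/std//|[v [vf' nv f'v]]] := max_nonstandard G f'.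
apply: (IH v) => //; first exact: f'le.
by apply: contraNneq f'u => <-.
Qed.

Section ReducedBasis.
Variable K : fieldType.
Implicit Types J G : set {mpoly K[n]}.

(** Reduced Groebner bases in terms of leading terms only, without monomial
    ideals. *)
Definition reduced_gb J G := [/\ finite_set G, G `<=` J,
  forall g, G g -> g@_(lterm le g) = 1,
  forall P, J P -> P != 0 -> exists2 g, G g & (lterm le g <= lterm le P)%MM &
  forall g h t, G g -> G h -> t \in msupp g -> (lterm le h <= t)%MM -> h = g].

Lemma monic_neq0 (g : {mpoly K[n]}) : g@_(lterm le g) = 1 -> g != 0.
Proof.
by move=> g1; apply/eqP => g0; move/eqP: g1; rewrite g0 mcoeff0 eq_sym oner_eq0.
Qed.

Lemma reduced_gbP J G : reduced_groebner_basis le J G <-> reduced_gb J G.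
Proof.
split=> [[[finG GJ leadE] red]|[finG GJ G1 Glead red]].
  have G1 g : G g -> g@_(lterm le g) = 1 by move=> /red[].
  split=> // [P JP P0|g h t Gg Gh tg ht].
    have : lead_ideal le J 'X_[lterm le P].
      by apply/lead_idealP; exists P; split=> //; exact: lepm_refl.
    by rewrite -leadE => /lead_idealP[g [Gg _ gP]]; exists g.
  apply: contrapT => hg; have [_ /(_ t tg)] := red g Gg.
  apply; apply/lead_idealP; exists h; split=> //.
  exact/monic_neq0/G1.
split; last first.
  move=> g Gg; split; first exact: G1.
  move=> t tg /lead_idealP[h [[Gh hg] _ ht]]; apply: hg; exact: red tg ht.
split=> //; apply/seteqP; split.
  apply: gen_ideal_min; first exact: gen_ideal_ideal.
  by move=> _ [P [GP P0] <-]; apply: sub_gen_ideal; exists P => //; split=> //; exact: GJ.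
apply: gen_ideal_min; first exact: gen_ideal_ideal.
move=> _ [P [JP P0] <-]; apply/lead_idealP.
have [g Gg gP] := Glead P JP P0; exists g; split=> //; exact/monic_neq0/G1.
Qed.

Lemma standard0 J G P : reduced_gb J G -> J P ->
  (forall t, t \in msupp P -> standard G t) -> P = 0.
Proof.
move=> [_ _ _ Glead _] JP stdP; apply/eqP; apply: contrapT => /negP P0.
by have [g Gg] := Glead P JP P0; apply/negP/stdP => //; exact: lterm_supp.
Qed.

(** The leading terms of both bases are the minimal leading terms of [J]. If [g]
    and [h] share one, [g - h] is in [J] and its leading term is a smaller term of
    [g] or of [h], which would be reducible. *)
Lemma reduced_gb_sub J G G' :
  is_ideal J -> reduced_gb J G -> reduced_gb J G' -> G `<=` G'.
Proof.
move=> iJ rG rG' g Gg.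
have [_ GJ G1 Glead Gred] := rG; have [_ G'J G'1 G'lead G'red] := rG'.
have g0 := monic_neq0 (G1 g Gg).
have [h Gh hg] := G'lead g (GJ _ Gg) g0.
have [g' Gg' g'h] := Glead h (G'J _ Gh) (monic_neq0 (G'1 h Gh)).
have g'E : g' = g.
  by apply: (Gred _ _ (lterm le g)) => //; [exact: lterm_supp|exact: lepm_trans hg].
have ltE : lterm le h = lterm le g.
  apply: (le_anti leT); first exact: lepm_le.
  by apply: lepm_le => //; rewrite -g'E.
suff /eqP : g - h = 0 by rewrite subr_eq0 => /eqP->.
have Jgh : J (g - h) by apply: ideal_sub => //; [exact: GJ | exact: G'J].
apply/eqP; apply: contrapT => /negP gh0.
set t := lterm le (g - h); have tgh : t \in msupp (g - h) by exact: lterm_supp.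
have tneq : t <> lterm le g.
  move=> tE; move: tgh; rewrite mcoeff_msupp mcoeffB tE G1// -ltE G'1//.
  by rewrite subrr eqxx.
have tle : le t (lterm le g).
  move: tgh => /msuppB_le; rewrite mem_cat => /orP[|] /(lterm_ge leT)//.
  by rewrite ltE.
have nogt (k : {mpoly K[n]}) : lterm le k = lterm le g -> (lterm le k <= t)%MM -> False.
  move=> kg /(lepm_le leT); rewrite kg => gt.
  by apply: tneq; apply: (le_anti leT).
move: tgh => /msuppB_le; rewrite mem_cat => /orP[tg|th].
  have [k Gk kt] := Glead _ Jgh gh0.
  by apply: (nogt k) => //; rewrite (Gred _ _ _ Gg Gk tg kt).
have [k Gk kt] := G'lead _ Jgh gh0.
by apply: (nogt k) => //; rewrite (G'red _ _ _ Gh Gk th kt).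
Qed.

Lemma reduced_gb_uniq J G G' : is_ideal J -> reduced_gb J G -> reduced_gb J G' -> G = G'.
Proof.
move=> iJ rG rG'; apply/seteqP.
by split; [exact: (reduced_gb_sub iJ rG) | exact: (reduced_gb_sub iJ rG')].
Qed.

(** For each minimal leading term [d] of [J], subtract from the term [d] its
    remainder modulo all the monic elements of [J]. Dickson's lemma makes the family
    finite. *)
Lemma reduced_gb_exists J : is_ideal J -> exists G, reduced_gb J G.
Proof.
move=> iJ; have [_ JD _] := iJ.
pose E := [set t | exists P : {mpoly K[n]}, [/\ J P, P@_t = 1 & lterm le P = t]].
pose G1 := [set P : {mpoly K[n]} | J P /\ P@_(lterm le P) = 1].
have stdE t e : standard G1 t -> E e -> (e <= t)%MM -> False.
  move=> st [P [JP P1 Pe]]; apply/negP; rewrite -Pe; apply: st.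
  by split=> //; rewrite Pe.
have EP P : J P -> P != 0 -> E (lterm le P).
  move=> JP P0; have cP : P@_(lterm le P) != 0.
    by rewrite -mcoeff_msupp; exact: lterm_supp.
  exists ((P@_(lterm le P))^-1 *: P); split; first exact: ideal_scale.
    by rewrite mcoeffZ mulVf.
  apply: lterm_eq => //.
    by rewrite mcoeff_msupp mcoeffZ mulVf// oner_eq0.
  by move=> u /msuppZ_le; exact: lterm_ge.
pose D := [set d | E d /\ forall e, E e -> (e <= d)%MM -> e = d].
have finD : finite_set D.
  have [D0 [finD0 D0E D0B]] := dickson E; apply: sub_finite_set finD0.
  by move=> d [Ed dmin]; have [e De /(dmin _ (D0E _ De))<-] := D0B d Ed.
have Dcover t : E t -> exists2 d, D d & (d <= t)%MM.
  move=> Et; have [|d [Ed dt] dmin] := @le_min _ _ leT [set e | E e /\ (e <= t)%MM].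
    by exists t; split=> //; exact: lepm_refl.
  exists d => //; split=> // e Ee ed; apply: (le_anti leT); first exact: lepm_le.
  by apply: dmin; split=> //; exact: lepm_trans dt.
have /choice[phi phiP] d : exists g, D d ->
    [/\ J g, g@_d = 1, lterm le g = d &
      forall t, t \in msupp g -> t <> d -> standard G1 t].
  have [Dd|nD] := EM (D d); last by exists 0.
  have [[P [JP P1 Pd]] _] := Dd.
  (* [P - 'X_[d]] only has terms below [d], hence so has its remainder [r], and
     ['X_[d] + r] is the required element. *)
  pose U := [set t | le t d /\ t <> d].
  pose W := [set Q | J Q /\ forall t, t \in msupp Q -> U t].
  have fU t : t \in msupp (P - 'X_[d]) -> U t.
    move=> tf; split; last first.
      by move=> td; move: tf; rewrite mcoeff_msupp td mcoeffB P1 mcoeffX eqxx subrr eqxx.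
    move: tf => /msuppB_le; rewrite mem_cat msuppX inE -Pd => /orP[|/eqP->].
      exact: lterm_ge.
    exact: le_refl.
  have Udown t u : U u -> le t u -> U t.
    move=> [ud und] tu; split; first exact: le_tr ud.
    by move=> td; apply: und; apply: (le_anti leT) => //; rewrite -td.
  have [|||P' Q' [JP' WP'] [JQ' WQ']|a s g _ [Jg g1] Usg|||r [Jr Ur] rstd] :=
      @division _ G1 setT U W (P - 'X_[d]) _ _ Udown.
  - by move=> g [].
  - by [].
  - by split; [case: iJ | move=> t; rewrite msupp0].
  - split; first exact: JD.
    by move=> t /msuppD_le; rewrite mem_cat => /orP[/WP'|/WQ'].
  - split; first by apply: ideal_scale => //; case: iJ => _ _; apply.
    move=> t /msuppZ_le /msuppM_le /allpairsP[[b c] /= [+ /(lterm_ge leT) cg ->]].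
    rewrite msuppX inE => /eqP->; apply: Udown Usg _.
    by case: leT => _ _ _ _; apply.
  - by [].
  - by move=> t /fU.
  have rU t : t \in msupp r -> U t.
    rewrite -[r in msupp r](subKr (P - 'X_[d])) => /msuppB_le.
    by rewrite mem_cat => /orP[/fU|/Ur].
  have rd : r@_d = 0 by apply: memN_msupp_eq0; apply/negP => /rU[].
  exists ('X_[d] + r) => _.
  have gd : ('X_[d] + r)@_d = 1 by rewrite mcoeffD mcoeffX eqxx rd addr0.
  split=> //.
  + rewrite (_ : _ + r = P - (P - 'X_[d] - r)); first exact: ideal_sub.
    by rewrite -addrA -opprD subKr.
  + apply: lterm_eq => //; first by rewrite mcoeff_msupp gd oner_eq0.
    move=> t /msuppD_le; rewrite mem_cat msuppX inE => /orP[/eqP->|/rU[]//].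
    exact: le_refl.
  + move=> t /msuppD_le; rewrite mem_cat msuppX inE => /orP[/eqP->|/rstd//].
    by [].
exists (phi @` D); split.
- exact: finite_image.
- by move=> _ [d Dd <-]; have [] := phiP d Dd.
- by move=> _ [d Dd <-]; have [_ g1 gd _] := phiP d Dd; rewrite gd.
- move=> P JP /(EP P JP)/Dcover[d Dd dP]; exists (phi d); first by exists d.
  by have [_ _ ->] := phiP d Dd.
- move=> _ _ t [d Dd <-] [e De <-] tg.
  have [_ _ gd gstd] := phiP d Dd; have [_ _ -> _] := phiP e De => et.
  have [td|td] := EM (t = d); last by case: (stdE t e) => //; [exact: gstd|case: De].
  by rewrite td in et; case: Dd => _ dmin; rewrite (dmin e)//; case: De.
Qed.

End ReducedBasis.
End GroebnerTheory.

(** * Specialization of reduced Groebner bases *)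

Section Fibres.
Variables (A : comNzRingType) (n : nat).

Section Fibre.
Variables (K : fieldType) (rho : {rmorphism A -> K}).

(** [K] is the residue field at the kernel of [rho]. Everything about
    specialization only needs this, and it is stated for two such morphisms [rho]
    and [tau], the kernel of [rho] being contained in that of [tau]. *)
Definition fractional := forall c : K, exists a s, rho s != 0 /\ rho a = rho s * c.

Hypothesis rho_frac : fractional.

Lemma mpoly_frac (Q : {mpoly K[n]}) :
  exists P s, rho s != 0 /\ map_mpoly rho P = rho s *: Q.
Proof.
elim/mpolyind: Q => [|c m Q _ _ [P [s [ps PQ]]]].
  by exists 0, 1; rewrite rmorph1 oner_eq0 rmorph0 scaler0.
have [a [u [pu ac]]] := rho_frac c.
exists ((s * a) *: 'X_[m] + u *: P), (u * s); split.
  by rewrite rmorphM mulf_neq0.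
rewrite rmorphD /= !map_mpolyZ map_mpolyX PQ !rmorphM /= ac.
by rewrite scalerDr !scalerA mulrA [rho s * _]mulrC.
Qed.

Variable I : set {mpoly A[n]}.
Hypothesis iI : is_ideal I.

Definition fibre : set {mpoly K[n]} := gen_ideal (map_mpoly rho @` I).

Lemma fibre_ideal : is_ideal fibre.
Proof. exact: gen_ideal_ideal. Qed.

(** Clearing denominators turns an element of the fibre into the image of one
    element of [I]. *)
Lemma fibreP h : fibre h <->
  exists P s, [/\ I P, rho s != 0 & map_mpoly rho P = rho s *: h].
Proof.
have [I0 ID IM] := iI; split; last first.
  move=> [P [s [IP /mulVf s1 Ph]]].
  rewrite -[h]scale1r -s1 -scalerA -Ph; apply: (ideal_scale _ fibre_ideal).
  by apply: sub_gen_ideal; exists P.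
move: h; apply: gen_ideal_min => [|_ [P IP <-]]; last first.
  by exists P, 1; rewrite rmorph1 oner_eq0 scale1r.
split.
- by exists 0, 1; rewrite rmorph1 oner_eq0 rmorph0 scaler0.
- move=> f g [P [s [IP ps Pf]]] [Q [u [IQ pu Qg]]].
  exists (u *: P + s *: Q), (u * s); split; last 1 first.
  + by rewrite rmorphD /= !map_mpolyZ Pf Qg rmorphM scalerDr !scalerA [rho s * _]mulrC.
  + by apply: ID; exact: ideal_scale.
  + by rewrite rmorphM mulf_neq0.
- move=> f g [P [s [IP ps Pg]]]; have [Q [u [pu Qf]]] := mpoly_frac f.
  exists (Q * P), (u * s); split; [exact: IM | by rewrite rmorphM mulf_neq0|].
  by rewrite !rmorphM /= Pg Qf -scalerAl -scalerAr scalerA.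
Qed.

End Fibre.

Section Specialization.
Variables (le : rel 'X_{1..n}) (I : set {mpoly A[n]}) (K L : fieldType).
Variables (rho : {rmorphism A -> K}) (tau : {rmorphism A -> L}).
Hypotheses (leT : term_order le) (iI : is_ideal I).
Hypothesis tau_frac : fractional tau.
Hypothesis rho_tau : forall a, rho a = 0 -> tau a = 0.

Lemma specialize_eq a b : rho a = rho b -> tau a = tau b.
Proof.
move=> /eqP; rewrite -subr_eq0 -rmorphB => /eqP /rho_tau /eqP.
by rewrite rmorphB subr_eq0 => /eqP.
Qed.

Variables (G : set {mpoly K[n]})
  (sigma : {mpoly K[n]} -> {mpoly L[n]}).
Hypothesis rG : reduced_gb le (fibre rho I) G.
Hypothesis sigmaP : forall g, G g -> exists P f, [/\ I P, tau f != 0,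
  map_mpoly rho P = rho f *: g &
  map_mpoly tau P = tau f *: sigma g].

Lemma msupp_specialize g : G g -> {subset msupp (sigma g) <= msupp g}.
Proof.
move=> /sigmaP[P [f [_ qf Pp Pq]]] t; apply: contraTT => /memN_msupp_eq0 g0.
rewrite -mcoeff_eq0.
have /(congr1 (mcoeff t)) := Pp; rewrite mcoeff_map_mpoly mcoeffZ g0 mulr0.
move=> /rho_tau Pt.
have /(congr1 (mcoeff t)) := Pq; rewrite mcoeff_map_mpoly mcoeffZ /= Pt => /esym/eqP.
by rewrite mulf_eq0 (negbTE qf).
Qed.

Lemma mcoeff_specialize g : G g -> (sigma g)@_(lterm le g) = 1.
Proof.
move=> Gg; have [P [f [_ qf Pp Pq]]] := sigmaP Gg; have [_ _ G1 _ _] := rG.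
have /(congr1 (mcoeff (lterm le g))) := Pp.
rewrite mcoeff_map_mpoly mcoeffZ G1// mulr1 => /specialize_eq Pt.
have /(congr1 (mcoeff (lterm le g))) := Pq.
rewrite mcoeff_map_mpoly mcoeffZ /= Pt -[LHS]mulr1.
by move=> /(mulfI qf)<-.
Qed.

Lemma lterm_specialize g : G g -> lterm le (sigma g) = lterm le g.
Proof.
move=> Gg; apply: lterm_eq => //.
  by rewrite mcoeff_msupp mcoeff_specialize// oner_eq0.
by move=> u /(msupp_specialize Gg); exact: lterm_ge.
Qed.

Lemma standard_specialize t : standard le (sigma @` G) t <-> standard le G t.
Proof.
split=> [st g Gg|st _ [g Gg <-]]; last by rewrite lterm_specialize//; exact: st.
by rewrite -lterm_specialize//; apply: st; exists g.
Qed.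

(** Write [h] as [tau Q / tau s] with [Q] in [I]: the reducible terms of [Q] have
    coefficients killed by [tau]. Divide [rho Q] by [G], keeping all coefficients in
    the set [coefs] of the fractions [a / f] with [tau a = 0] and [tau f <> 0]. The
    remainder is in the fibre of [rho] and irreducible, thus zero, so [tau] kills
    every coefficient of [Q]. *)
Lemma fibre_specialize h : fibre tau I h ->
  (forall t, t \in msupp h -> standard le G t) -> h = 0.
Proof.
move=> /(fibreP tau_frac iI)[Q [s [IQ qs Qh]]] hstd.
have [_ GJ G1 _ _] := rG.
have iJ : is_ideal (fibre rho I) by exact: fibre_ideal.
pose coefs := [set c | exists a f, [/\ tau a = 0, tau f != 0 & rho a = rho f * c]].
have coefs0 : coefs 0.
  by exists 0, 1; rewrite rmorph0 rmorph1 oner_eq0 rmorph0 mulr0.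
have coefsB a b : coefs a -> coefs b -> coefs (a - b).
  move=> [a' [f [qa qf aE]]] [b' [g [qb qg bE]]].
  exists (g * a' - f * b'), (f * g); split; last 1 first.
  - rewrite rmorphB !rmorphM /= aE bE mulrBr !mulrA.
    by rewrite [rho g * _]mulrC.
  - by rewrite rmorphB !rmorphM /= qa qb !mulr0 subr0.
  - by rewrite rmorphM mulf_neq0.
have coefsD a b : coefs a -> coefs b -> coefs (a + b).
  move=> ma mb; have := coefsB _ _ ma (coefsB _ _ coefs0 mb).
  by rewrite sub0r opprK.
have coefsE a : coefs (rho a) -> tau a = 0.
  move=> [b [f [qb qf]]]; rewrite -rmorphM => /specialize_eq/esym/eqP.
  by rewrite rmorphM qb mulf_eq0 (negbTE qf) => /eqP.
have coefsG a g t : coefs a -> G g -> coefs (a * g@_t).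
  move=> [a' [f [qa qf aE]]] /sigmaP[P [u [_ qu Pp _]]].
  have /(congr1 (mcoeff t)) := Pp; rewrite mcoeff_map_mpoly mcoeffZ => Pt.
  exists (a' * P@_t), (f * u); split; last 1 first.
  - by rewrite !rmorphM /= aE Pt mulrACA.
  - by rewrite rmorphM /= qa mul0r.
  - by rewrite rmorphM mulf_neq0.
have [|||||||r [Jr mr] rstd] := @division _ _ leT _ G coefs setT
  [set P | fibre rho I P /\ forall t, coefs P@_t] (map_mpoly rho Q) G1.
- by move=> a b g t ma mb Gg; apply: coefsB => //; exact: coefsG.
- by [].
- by split=> [|t]; [case: iJ | rewrite mcoeff0].
- move=> P' Q' [JP mP] [JQ mQ]; split; first by case: iJ => _ + _; apply.
  by move=> t; rewrite mcoeffD; exact: coefsD.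
- move=> a u g ma Gg _; split.
    by apply: (ideal_scale _ iJ) => //; case: iJ => _ _; apply; exact: GJ.
  move=> t; rewrite mcoeffZ mcoeffXM; case: ifP => _; first exact: coefsG.
  by rewrite mulr0.
- move=> t nt; exists Q@_t, 1; rewrite rmorph1 oner_eq0 rmorph1 mul1r mcoeff_map_mpoly.
  split=> //; rewrite -mcoeff_map_mpoly Qh mcoeffZ.
  by rewrite memN_msupp_eq0 ?mulr0//; apply/negP => /hstd.
- by [].
have r0 : r = 0.
  apply: (standard0 leT rG _ rstd).
  rewrite -[r](subKr (map_mpoly rho Q)); apply: (ideal_sub iJ) => //.
  by apply: sub_gen_ideal; exists Q.
apply/mpolyP => t; rewrite mcoeff0.
have /(congr1 (mcoeff t)) := Qh.
have := mr t; rewrite r0 subr0 !mcoeff_map_mpoly mcoeffZ /= => /coefsE ->.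
move=> /esym/eqP.
by rewrite mulf_eq0 (negbTE qs) => /eqP.
Qed.

(** If the leading term of [h] were irreducible, dividing [h] would leave it in
    place and yield a nonzero irreducible element of the fibre of [tau]. *)
Lemma reduced_gb_specialize : reduced_gb le (fibre tau I) (sigma @` G).
Proof.
have iJ : is_ideal (fibre tau I) by exact: fibre_ideal.
have sJ g : G g -> fibre tau I (sigma g).
  by move=> /sigmaP[P [f [IP qf _ Pq]]]; apply/(fibreP tau_frac iI); exists P, f.
have [finG GJ G1 Glead Gred] := rG.
split.
- exact: finite_image.
- by move=> _ [g Gg <-]; exact: sJ.
- by move=> _ [g Gg <-]; rewrite lterm_specialize// mcoeff_specialize.
- move=> h Jh h0; apply: contrapT => nh.
  set u := lterm le h.
  have ustd : standard le (sigma @` G) u.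
    by move=> g sg; apply/negP => gu; apply: nh; exists g.
  pose U := [set t | le t u /\ t <> u].
  have [||||||||r [Jr r0] rstd] := @division _ _ leT _ (sigma @` G) setT U
    [set P | fibre tau I P /\ P@_u = 0] h.
  + by move=> _ [g Gg <-]; rewrite lterm_specialize// mcoeff_specialize.
  + by [].
  + move=> t v [vu vnu] tv; split; first exact: le_tr vu.
    by move=> tu; apply: vnu; apply: (le_anti leT) => //; rewrite -tu.
  + by split; [case: iJ | rewrite mcoeff0].
  + move=> P Q [JP P0] [JQ Q0]; split; first by case: iJ => _ + _; apply.
    by rewrite mcoeffD P0 Q0 addr0.
  + move=> a s _ _ [g Gg <-] [su snu]; split.
      by apply: (ideal_scale _ iJ) => //; case: iJ => _ _; apply; exact: sJ.
    rewrite memN_msupp_eq0//; apply/negP => /msuppZ_le /msuppM_le.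
    move=> /allpairsP[[b c] /= [+ /(lterm_ge leT) cg uE]].
    rewrite msuppX inE => /eqP bE; apply: snu; apply: (le_anti leT) => //.
    by rewrite [X in le X _]uE bE; case: leT => _ _ _ _; apply.
  + by [].
  + move=> t th nt; split; first exact: lterm_ge.
    by move=> tu; apply: nt; rewrite tu.
  have r0' : r = 0.
    apply: fibre_specialize; last by move=> t /rstd /standard_specialize.
    by rewrite -[r](subKr h); apply: (ideal_sub iJ).
  have := lterm_supp leT h0; rewrite -/u mcoeff_msupp.
  by move: r0; rewrite r0' subr0 => ->; rewrite eqxx.
- move=> _ _ t [g Gg <-] [h Gh <-] /(msupp_specialize Gg) tg.
  by rewrite lterm_specialize// => ht; rewrite (Gred g h t).
Qed.

End Specialization.
End Fibres.

Arguments fibre {A n K} rho I.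

(** * Topology of the spectrum *)

Section MapMpoly.
Variables (n : nat) (R S : comNzRingType) (f : {rmorphism R -> S}).
Implicit Types (P Q : {mpoly R[n]}) (m : 'X_{1..n}).

Lemma map_mpoly_eq_coeff P Q m :
  map_mpoly f P = map_mpoly f Q -> f (P@_m - Q@_m) = 0.
Proof.
move=> /(congr1 (mcoeff m)); rewrite !mcoeff_map_mpoly /= rmorphB => ->.
exact: subrr.
Qed.

Lemma map_mpolyE_coeff P (c : S) (h : {mpoly S[n]}) :
  map_mpoly f P = c *: h <-> forall m, f P@_m = c * h@_m.
Proof.
split=> [PE m|PE]; first by rewrite -mcoeffZ -PE mcoeff_map_mpoly.
by apply/mpolyP => m; rewrite mcoeffZ mcoeff_map_mpoly; exact: PE.
Qed.

Lemma map_mpoly_scaleP (R' : comNzRingType) (g : {rmorphism R' -> S}) P (c : S)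
    (h : {mpoly R'[n]}) :
  map_mpoly f P = c *: map_mpoly g h <-> forall m, f P@_m = c * g h@_m.
Proof.
split=> [/map_mpolyE_coeff PE m|PE]; first by rewrite PE mcoeff_map_mpoly.
by apply/map_mpolyE_coeff => m; rewrite mcoeff_map_mpoly; exact: PE.
Qed.

End MapMpoly.

Section ZariskiTopology.
Variable A : comNzRingType.
Implicit Types (p q : Spec A) (U F Y : set (Spec A)).

Definition specializations p : set (Spec A) := [set q : Spec A | {subset p <= q}].

Lemma open_basic U p : open U -> U p ->
  exists2 s, s \notin p & forall q, s \notin q -> U q.
Proof.
move=> [S US] Up; apply: contrapT => nos.
suff : (~` U) p by [].
rewrite US => a Sa; apply: contrapT => /negP pa; apply: nos; exists a => // q qa.
apply: contrapT => nUq; have : (~` U) q by [].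
by rewrite US => /(_ _ Sa); rewrite (negbTE qa).
Qed.

Lemma closed_zeros (S : set A) : closed (zeros S).
Proof. by rewrite -openC; exists S; rewrite setCK. Qed.

Lemma open_basic_open (s : A) : open [set p : Spec A | s \notin p].
Proof.
rewrite -closedC (_ : ~` _ = zeros [set s]); first exact: closed_zeros.
apply/seteqP; split=> [p /negP|p /(_ s erefl) ps]; last by apply/negP; rewrite negbK.
by rewrite negbK => ps _ ->.
Qed.

Lemma closed_specializations p : closed (specializations p).
Proof.
rewrite (_ : specializations p = zeros [set a | a \in p]); first exact: closed_zeros.
by apply/seteqP; split.
Qed.

Lemma open_generization U p q : open U -> {subset p <= q} -> U q -> U p.
Proof.
move=> oU pq /(open_basic oU)[s qs]; apply; exact: contraNN (pq s) qs.
Qed.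

Lemma closed_specialization F p q : closed F -> {subset p <= q} -> F p -> F q.
Proof.
move=> cF pq Fp; apply: contrapT => nFq.
by have /(_ nFq) := @open_generization (~` F) p q (closed_openC cF) pq.
Qed.

Lemma closureP Y q :
  closure Y q <-> forall a, (forall p, Y p -> a \in p) -> a \in q.
Proof.
rewrite closureE; split=> [clq a Ya|aq F [cF YF]].
  by apply: (clq (zeros [set a])) => //; split=> [|p Yp _ ->];
    [exact: closed_zeros | exact: Ya].
apply: contrapT => nFq; have [s qs sF] := open_basic (closed_openC cF) nFq.
move/negP: qs; apply; apply: aq => p /YF Fp; apply: contrapT => /negP ps.
exact: sF ps Fp.
Qed.

Lemma locally_closed_generization Y p q : locally_closed Y ->
  closure Y p -> {subset p <= q} -> Y q -> Y p.
Proof.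
move=> [U [F [oU cF ->]]] clp pq [Uq _]; split; first exact: open_generization Uq.
by move: clp; rewrite closureE; apply; split=> // r [].
Qed.

(** Constructibility of [Y], checked on the irreducible closed sets [V(p)]: near
    its generic point, [Y] contains either all of [V(p)] or nothing. Stability under
    Boolean operations is immediate in this form. *)
Definition constructible Y := forall p, exists2 s, s \notin p &
  forall q, {subset p <= q} -> s \notin q -> (Y q <-> Y p).

Lemma open_constructible U : open U -> constructible U.
Proof.
move=> oU p; have [Up|nUp] := EM (U p).
  by have [s ps sU] := open_basic oU Up; exists s => // q _ /sU.
exists 1; first exact: notin_prime1.
by move=> q pq _; split=> // Uq; apply: open_generization Uq.
Qed.

Lemma setC_constructible Y : constructible Y -> constructible (~` Y).
Proof.
move=> cY p; have [s ps sY] := cY p; exists s => // q pq qs.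
by split=> h /(sY q pq qs).
Qed.

Lemma setI_constructible Y Z :
  constructible Y -> constructible Z -> constructible (Y `&` Z).
Proof.
move=> cY cZ p; have [s ps sY] := cY p; have [t pt tZ] := cZ p.
exists (s * t); first exact: notin_primeM.
move=> q pq; rewrite prime_idealrM negb_or => /andP[qs qt].
by split=> -[/(sY q pq qs) ? /(tZ q pq qt) ?].
Qed.

Lemma locally_closed_constructible Y : locally_closed Y -> constructible Y.
Proof.
move=> [U [F [oU cF ->]]]; apply: setI_constructible; first exact: open_constructible.
by rewrite -[F]setCK; apply/setC_constructible/open_constructible/closed_openC.
Qed.

Lemma lcset_eq (Y Z : lcset A) : Y = Z :> set (Spec A) -> Y = Z.
Proof.
case: Y Z => Y cY Y0 [Z cZ Z0] /= e; subst Z.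
by congr MkLcset; exact: Prop_irrelevance.
Qed.

End ZariskiTopology.

(** * Sections over a locally closed set *)

Section Sections.
Variables (A : comNzRingType) (Y : lcset A).

Lemma barpN (y : lcpt Y) (f : A) : (tobar Y f \notin barp y) = (f \notin sval y).
Proof. by rewrite -(barp_pi y). Qed.

Lemma tobar_eq (a b : A) : (forall p, lccar Y p -> a - b \in p) -> tobar Y a = tobar Y b.
Proof.
move=> ab; apply/eqP; rewrite -Quotient.idealrBE; exact/asboolP.
Qed.

Lemma eval_at_frac (y : lcpt Y) (s : OY Y) b f (hf : tobar Y f \notin barp y) :
  s y = mkfrac (tobar Y b) hf -> eval_at y s = res (sval y) b / res (sval y) f.
Proof. by move=> sE; rewrite /eval_at /germ sE stalk_res_frac !resbar_tobar. Qed.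

(** If the numerator [b] of [s] near [y] vanishes on the basic open set of [u],
    then [u b] vanishes on all of [Y], so [u b = 0] in [A/a] and the germ is zero. *)
Lemma OY_reduced (s : OY Y) : (forall y, eval_at y s = 0) -> s = 0.
Proof.
move=> s0; apply: OY_eq => y.
have [U [oU Uy [b [f bf]]]] := OYP s y; have [u yu uU] := open_basic oU Uy.
have [hf ->] := bf y Uy; apply/mkfracP; exists (tobar Y u); first by rewrite barpN.
rewrite mulr1 mul0r mulr0 -[b]tobarK -rmorphM -(rmorph0 (tobar Y)).
apply: tobar_eq => q Yq; rewrite subr0 prime_idealrM.
have [//|qu] := boolP (u \in q); rewrite orFb.
have [hq sq] := bf (exist _ q Yq) (uU q qu).
have /eqP := s0 (exist _ q Yq); rewrite /eval_at /germ sq stalk_res_frac.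
by rewrite mulf_eq0 invr_eq0 (negbTE (resbar_neq0 hq)) orbF res_eq0.
Qed.

Lemma OY_poly_ext n (g h : {mpoly (OY Y)[n]}) :
  (forall y, map_mpoly (eval_at y) g = map_mpoly (eval_at y) h) -> g = h.
Proof.
move=> gh; apply/mpolyP => m; apply/eqP; rewrite -subr_eq0; apply/eqP.
by apply: OY_reduced => y; exact: (map_mpoly_eq_coeff m (gh y)).
Qed.

Section Ibar.
Variables (n : nat) (I : set {mpoly A[n]}).

Lemma tobar_poly_surj (Q : {mpoly (Abar Y)[n]}) :
  exists P, map_mpoly (tobar Y) P = Q.
Proof.
elim/mpolyind: Q => [|c m Q _ _ [P <-]]; first by exists 0; rewrite rmorph0.
by exists (repr c *: 'X_[m] + P); rewrite rmorphD /= map_mpolyZ map_mpolyX /= tobarK.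
Qed.

Lemma IbarP (Q : {mpoly (Abar Y)[n]}) : is_ideal I -> Ibar I Q ->
  exists2 P, I P & map_mpoly (tobar Y) P = Q.
Proof.
move=> [I0 ID IM]; move: Q; apply: gen_ideal_min => //; split.
- by exists 0; rewrite ?rmorph0.
- move=> _ _ [P IP <-] [Q IQ <-]; exists (P + Q); last by rewrite rmorphD.
  exact: ID.
- move=> f _ [P IP <-]; have [Q <-] := tobar_poly_surj f.
  by exists (Q * P); [exact: IM | rewrite rmorphM].
Qed.

End Ibar.

Section GenericPoint.
Variable y0 : lcpt Y.
Local Notation p := (sval y0).
Hypothesis pY : Y `<=` specializations p.

(** Over a [Y] with generic point [p], germs at any point are determined by their
    image in [k(p)]. *)
Lemma mkfrac_generic (y : lcpt Y) (c : kappa p) a b f g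
    (hf : tobar Y f \notin barp y) (hg : tobar Y g \notin barp y) :
  res p a = res p f * c -> res p b = res p g * c ->
  mkfrac (tobar Y a) hf = mkfrac (tobar Y b) hg.
Proof.
move=> ac bc; apply: mkfrac_eq; rewrite -!rmorphM; apply: tobar_eq => q /pY; apply.
rewrite -res_eq0 rmorphB !rmorphM /= ac bc subr_eq0; apply/eqP.
by rewrite mulrC -mulrA [c * _]mulrC.
Qed.

Definition spreads_over (c : kappa p) :=
  forall y : lcpt Y, exists a f, f \notin sval y /\ res p a = res p f * c.

(** Fractions representing the same [c] in [k(p)] near the various points of [Y]
    glue. *)
Lemma spread_exists (c : kappa p) : exists s : OY Y, spreads_over c ->
  forall y a f (hf : tobar Y f \notin barp y), res p a = res p f * c ->
  s y = mkfrac (tobar Y a) hf.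
Proof.
have [/choice[a /choice[f af]]|nc] := EM (spreads_over c); last by exists 0.
have hf y : tobar Y (f y) \notin barp y by rewrite barpN; case: (af y).
have reg : regular (fun y => mkfrac (tobar Y (a y)) (hf y)).
  move=> y; exists [set q : Spec A | f y \notin q]; split.
  - exact: open_basic_open.
  - by case: (af y).
  - exists (tobar Y (a y)), (tobar Y (f y)) => z fz.
    have hz : tobar Y (f y) \notin barp z by rewrite barpN.
    exists hz; apply: (@mkfrac_generic _ c); first by case: (af z).
    by case: (af y).
exists (MkOY reg) => _ y b g hg bg /=; apply: (@mkfrac_generic _ c) => //.
by case: (af y).
Qed.

Definition spread (c : kappa p) : OY Y := projT1 (cid (spread_exists c)).

Lemma spreadP c : spreads_over c ->
  forall y a f (hf : tobar Y f \notin barp y), res p a = res p f * c ->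
  spread c y = mkfrac (tobar Y a) hf.
Proof. exact: (projT2 (cid (spread_exists c))). Qed.

Definition spread_poly n (g : {mpoly (kappa p)[n]}) : {mpoly (OY Y)[n]} :=
  \sum_(m <- msupp g) spread g@_m *: 'X_[m].

Lemma spreads_over0 : spreads_over 0.
Proof.
move=> y; exists 0, 1; split; first exact: notin_prime1.
by rewrite rmorph0 mulr0.
Qed.

Lemma spread0 : spread 0 = 0.
Proof.
apply: OY_eq => y; have h1 : tobar Y 1 \notin barp y by rewrite barpN notin_prime1.
rewrite (@spreadP 0 spreads_over0 y 0 1 h1); last by rewrite rmorph0 mulr0.
by apply: mkfrac_eq; rewrite rmorph0 !mul0r.
Qed.

Lemma mcoeff_spread_poly n (g : {mpoly (kappa p)[n]}) m :
  (spread_poly g)@_m = spread g@_m.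
Proof.
rewrite raddf_sum /=; have [mg|mg] := boolP (m \in msupp g).
  rewrite (bigD1_seq m) ?msupp_uniq//= mcoeffZ mcoeffX eqxx mulr1.
  rewrite big1 ?addr0// => t /negbTE tm.
  by rewrite mcoeffZ mcoeffX tm mulr0.
rewrite memN_msupp_eq0// spread0 big_seq big1// => t tg.
rewrite mcoeffZ mcoeffX; case: eqP => [tm|_]; last by rewrite mulr0.
by rewrite -tm tg in mg.
Qed.

End GenericPoint.
End Sections.

(** * Strata *)

Lemma res_fractional (A : comNzRingType) (p : Spec A) : fractional (res p).
Proof.
move=> c; rewrite -[c]reprK -/(tokappa _); elim/loc_ind: (repr c) => a f hf.
exists a, f; split; first by rewrite res_eq0.
rewrite /= /res -rmorphM; congr tokappa.
by rewrite /toloc locM; apply: mkfrac_eq; rewrite !mul1r mulr1 mulrC.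
Qed.

Lemma open_finite_bigcap (T : topologicalType) (J : choiceType) (D : set J)
    (f : J -> set T) :
  finite_set D -> (forall i, D i -> open (f i)) -> open (\bigcap_(i in D) f i).
Proof.
move=> finD fo; rewrite -closedC setC_bigcap; apply: closed_bigcup => // i Di.
by rewrite -openC setCK; exact: fo.

Qed.

Lemma lepm_eq n (t u : 'X_{1..n}) : t = u -> (t <= u)%MM.
Proof. by move=> ->; exact: lepm_refl. Qed.

Section Strata.
Variables (A : comNzRingType) (n : nat) (le : rel 'X_{1..n}).
Variable I : set {mpoly A[n]}.
Hypotheses (leT : term_order le) (iI : is_ideal I).
Implicit Types (p q : Spec A) (L : set (Spec A)) (Y : lcset A).

Definition generic_gb p : set {mpoly (kappa p)[n]} :=
  projT1 (cid (reduced_gb_exists leT (fibre_ideal (res p) I))).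
Arguments generic_gb : clear implicits.

Lemma generic_gbP p : reduced_gb le (fibre (res p) I) (generic_gb p).
Proof. exact: (projT2 (cid (reduced_gb_exists leT (fibre_ideal (res p) I)))). Qed.

Definition extends_to p (g : {mpoly (kappa p)[n]}) q :=
  exists P f, [/\ I P, f \notin q & map_mpoly (res p) P = res p f *: g].

Definition stratum L p : set (Spec A) :=
  [set q | [/\ L q, specializations p q & forall g, generic_gb p g -> extends_to g q]].

Lemma stratum_generic L p : L p -> stratum L p p.
Proof.
move=> Lp; split=> // g gg.
have [_ /(_ _ gg) /(fibreP (@res_fractional _ p) iI)] := generic_gbP p.
by move=> [P [f [IP pf Pg]]]; exists P, f; rewrite -res_eq0.
Qed.

Lemma open_extends p (g : {mpoly (kappa p)[n]}) : open [set q | extends_to g q].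
Proof.
rewrite (_ : [set _ | _] = \bigcup_(Pf in [set Pf : {mpoly A[n]} * A |
    I Pf.1 /\ map_mpoly (res p) Pf.1 = res p Pf.2 *: g])
  [set q : Spec A | Pf.2 \notin q]).
  by apply: bigcup_open => Pf _; exact: open_basic_open.
apply/seteqP; split=> q [] => [P [f [IP qf Pg]]|[P f] /= [IP Pg] qf].
  by exists (P, f).
by exists P, f.
Qed.

Lemma stratum_locally_closed L p : locally_closed L -> locally_closed (stratum L p).
Proof.
move=> [U [F [oU cF LE]]].
exists (U `&` \bigcap_(g in generic_gb p) [set q | extends_to g q]),
       (F `&` specializations p); split.
- apply: openI => //; apply: open_finite_bigcap => [|g _]; last exact: open_extends.
  by case: (generic_gbP p).
- by apply: closedI => //; exact: closed_specializations.
- rewrite /stratum LE; apply/seteqP; split=> q; first by move=> [[Uq Fq] pq eq].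
  by move=> [[Uq eq] [Fq pq]].
Qed.

Lemma is_GYP Y (G : set {mpoly (OY Y)[n]}) : is_GY le I G ->
  forall y : lcpt Y, reduced_gb le (fibre (res (sval y)) I) (map_mpoly (eval_at y) @` G).
Proof.
move=> [_ _ GB _] y.
exact: (iffLR (@reduced_gbP n le (kappa (sval y)) _ _) (GB y)).
Qed.

(** At one point [y0] the two bases have the same values, so [g] and some [h] agree
    there. Leading terms being constant on [Y], the values of [g] and [h] at any
    [y] have the same leading term, and a reduced basis has at most one element with
    a given leading term. *)
Lemma is_GY_uniq Y (G H : set {mpoly (OY Y)[n]}) :
  is_GY le I G -> is_GY le I H -> G = H.
Proof.
have sub (G' H' : set {mpoly (OY Y)[n]}) :
    is_GY le I G' -> is_GY le I H' -> G' `<=` H'.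
  move=> GG GH g Gg; have [_ _ _ Glt] := GG; have [_ _ _ Hlt] := GH.
  have same (y : lcpt Y) :=
    reduced_gb_uniq leT (fibre_ideal _ I) (is_GYP GG y) (is_GYP GH y).
  have [p Yp] := lccar_n0 Y; pose y0 : lcpt Y := exist _ p Yp.
  have [h Hh hg] : (map_mpoly (eval_at y0) @` H') (map_mpoly (eval_at y0) g).
    by rewrite -same; exists g.
  suff -> : g = h by [].
  apply: OY_poly_ext => y; have [_ _ G1 _ Gred] := is_GYP GG y.
  have Ghy : (map_mpoly (eval_at y) @` G') (map_mpoly (eval_at y) h).
    by rewrite same; exists h.
  have Ggy : (map_mpoly (eval_at y) @` G') (map_mpoly (eval_at y) g) by exists g.
  apply: (Gred _ _ (lterm le (map_mpoly (eval_at y) h)) Ghy Ggy).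
    by apply: lterm_supp => //; apply: monic_neq0; exact: G1.
  apply: lepm_eq; apply: (etrans (Glt g Gg y y0)); apply: etrans (Hlt h Hh y0 y).
  exact: (congr1 (fun P => lterm le P) (esym hg)).
by move=> GG GH; apply/seteqP; split; exact: sub.
Qed.

Section Generic.
Variables (Y : lcset A) (y0 : lcpt Y).
Local Notation p := (sval y0).
Hypothesis pY : Y `<=` specializations p.

(** Near [q] the section [s] is [P/f] with [P] in [I]. This holds at [p] too, since
    open sets are stable under generization, and the value of [s] at [p] is [g]. *)
Lemma parametric_extends (q : Spec A) : parametric le I Y -> lccar Y q ->
  forall g, generic_gb p g -> extends_to g q.
Proof.
move=> [G GG] Yq g gg; pose y : lcpt Y := exist _ q Yq.
have [s Gs sg] : (map_mpoly (eval_at y0) @` G) g.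
  by rewrite (reduced_gb_uniq leT (fibre_ideal _ I) (is_GYP GG y0) (generic_gbP p)).
have [_ /(_ _ Gs y) [U [oU Uq [_ /(IbarP iI)[P IP <-] [f0 fU]]]] _ _] := GG.
have [f fE] : exists f, tobar Y f = f0 by exists (repr f0); rewrite tobarK.
rewrite -{}fE in fU.
have [hq _] := fU y Uq; have [hp sP] := fU y0 (open_generization oU (pY Yq) Uq).
exists P, f; split=> //; first by rewrite -(barpN y).
have rf : res p f != 0 by rewrite res_eq0 -(barpN y0).
rewrite -sg; apply/(map_mpoly_scaleP (res p) (eval_at y0)) => m.
have := (map_mpoly_scaleP (germ y0) (toloc (barp y0)) _ _ _).1 sP m.
rewrite /= /toloc locM => sm.
have sm' : s@_m y0 = mkfrac (tobar Y P@_m) hp.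
  by rewrite -/(germ y0 _) sm; apply: mkfrac_eq; rewrite mcoeff_map_mpoly mul1r mulr1.
by rewrite (eval_at_frac sm') /= mulrC divfK.
Qed.

Lemma spread_coeff (g : {mpoly (kappa p)[n]}) P f (y : lcpt Y)
    (hf : tobar Y f \notin barp y) :
  (forall q, lccar Y q -> extends_to g q) ->
  map_mpoly (res p) P = res p f *: g ->
  forall m, (spread_poly pY g)@_m y = mkfrac (tobar Y P@_m) hf.
Proof.
move=> gY Pg m; rewrite mcoeff_spread_poly; apply: spreadP.
  move=> z; have [Q [u [_ zu Qg]]] := gY _ (svalP z).
  exists Q@_m, u; split=> //.
  exact: (map_mpolyE_coeff (res p) Q _ _).1 Qg m.
exact: (map_mpolyE_coeff (res p) P _ _).1 Pg m.
Qed.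

(** The elements of the basis at the generic point spread out to sections. Their
    values at [y] are [tau P / tau f], which is the form required by
    [reduced_gb_specialize]. *)
Lemma extends_parametric :
  (forall q, lccar Y q -> forall g, generic_gb p g -> extends_to g q) -> parametric le I Y.
Proof.
move=> gY; exists (@spread_poly _ _ _ pY n @` generic_gb p).
have gE g : generic_gb p g -> forall q, lccar Y q -> extends_to g q.
  by move=> gg q Yq; exact: gY.
pose sigma (y : lcpt Y) (g : {mpoly (kappa p)[n]}) : {mpoly (kappa (sval y))[n]} :=
  map_mpoly (eval_at y) (spread_poly pY g).
have sp (y : lcpt Y) g : generic_gb p g -> exists P f, [/\ I P, res (sval y) f != 0,
    map_mpoly (res p) P = res p f *: g &
    map_mpoly (res (sval y)) P =
      res (sval y) f *: sigma y g].
  move=> gg; have [P [f [IP yf Pg]]] := gE g gg _ (svalP y).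
  have rf : res (sval y) f != 0 by rewrite res_eq0.
  exists P, f; split=> //.
  apply/(map_mpoly_scaleP (res (sval y)) (eval_at y)) => m.
  have hf : tobar Y f \notin barp y by rewrite barpN.
  have sm := spread_coeff hf (gE g gg) Pg m.
  by rewrite /= (eval_at_frac sm) mulrC divfK.
have pres (y : lcpt Y) a : res p a = 0 -> res (sval y) a = 0.
  by move=> /eqP; rewrite res_eq0 => /(pY (svalP y)); rewrite -res_eq0 => /eqP.
have finG : finite_set (generic_gb p) by case: (generic_gbP p).
split.
- exact: finite_image.
- move=> _ [g gg <-] y; have [P [f [IP yf Pg]]] := gE g gg _ (svalP y).
  exists [set q : Spec A | f \notin q]; split=> //; first exact: open_basic_open.
  exists (map_mpoly (tobar Y) P); first by apply: sub_gen_ideal; exists P.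
  exists (tobar Y f) => z fz; have hf : tobar Y f \notin barp z by rewrite barpN.
  exists hf; apply/(map_mpoly_scaleP (germ z) (toloc (barp z))) => m.
  rewrite /= /germ (spread_coeff hf (gE g gg) Pg) /toloc locM.
  by apply: mkfrac_eq; rewrite mcoeff_map_mpoly mul1r mulr1.
- move=> y; rewrite image_comp; apply: (iffRL (@reduced_gbP n le (kappa (sval y)) _ _)).
  exact: (@reduced_gb_specialize A n le I _ _ (res p) (res (sval y)) leT iI
    (@res_fractional _ _) (pres y) (generic_gb p) (sigma y) (generic_gbP p) (sp y)).
- move=> _ [g gg <-] y z.
  have lts (x : lcpt Y) : lterm le (sigma x g) = lterm le g.
    exact: (@lterm_specialize A n le I _ _ (res p) (res (sval x)) leT
      (pres x) (generic_gb p) (sigma x) (generic_gbP p) (sp x) g gg).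
  exact: etrans (lts y) (esym (lts z)).
Qed.

End Generic.
End Strata.

(** * Generic points in a noetherian spectrum *)

Section VanishingIdeal.
Variable A : comNzRingType.
Implicit Types (p q : Spec A) (Y : set (Spec A)).

Lemma Spec_eq p q : {subset p <= q} -> {subset q <= p} -> p = q.
Proof.
move=> pq qp; have {pq qp} : Spec_fun p = Spec_fun q.
  by apply/funext => a; apply/idP/idP; [exact: pq | exact: qp].
case: p q => f pf [g pg] /= e; subst g; congr MkSpec; exact: Prop_irrelevance.
Qed.

Definition vanishing Y : set A := [set a | forall p, Y p -> a \in p].

Lemma vanishing_ideal Y : is_ideal (vanishing Y).
Proof.
split=> [p _|x y vx vy p Yp|a x vx p Yp]; first exact: idealr0.
  by rewrite rpredD ?vx ?vy.
by rewrite idealMr// vx.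
Qed.

Lemma vanishing_prime Y : Y !=set0 ->
  (forall a b, vanishing Y (a * b) -> vanishing Y a \/ vanishing Y b) ->
  exists p, forall a, a \in p <-> vanishing Y a.
Proof.
move=> [q Yq] prime; pose f a := `[< vanishing Y a >].
have [v0 vD vM] := vanishing_ideal Y.
have fP : idealr_closed (f : {pred A}) /\ prime_idealr_closed (f : {pred A}).
  split; first split.
  - exact/asboolP.
  - by apply/negP => /asboolP/(_ q Yq); rewrite idealr1.
  - move=> a u v /asboolP vu /asboolP vv; apply/asboolP.
    by apply: vD => //; exact: vM.
  - by move=> a b /asboolP/prime[] h; apply/orP; [left | right]; exact/asboolP.
by exists (MkSpec fP) => a; split=> /asboolP.
Qed.

Lemma closure_generic Y p : Y p -> Y `<=` specializations p ->
  closure Y = specializations p.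
Proof.
move=> Yp pY; apply/seteqP; split=> q.
  by rewrite closureE; apply; split=> //; exact: closed_specializations.
move=> pq; apply: (closed_specialization _ pq); first exact: closed_closure.
exact: subset_closure.
Qed.

(** Irreducibility makes the vanishing ideal prime, and this prime belongs to [Y]
    because it lies in the closure of [Y] below a point of [Y]. *)
Lemma irreducible_generic Y : irreducible Y -> locally_closed Y ->
  exists2 p, Y p & Y `<=` specializations p.
Proof.
move=> [Y0 irr] lcY; have [q Yq] := Y0.
have [|p pP] := vanishing_prime Y0.
  move=> a b vab.
  have [||r Yr|h|h] := irr (zeros [set a]) (zeros [set b]).
  - exact: closed_zeros.
  - exact: closed_zeros.
  - have := vab r Yr; rewrite prime_idealrM => /orP[ra|rb]; [left|right]=> _ ->//.
  - by left => r /h; apply.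
  - by right => r /h; apply.
have pY : Y `<=` specializations p by move=> r Yr a /pP; apply.
exists p => //; apply: (locally_closed_generization lcY _ (pY q Yq) Yq).
by apply/closureP => a /pP.
Qed.

Hypothesis noethA : noetherian A.

(** Zorn's lemma: the union of a chain in [Fam] is an ideal, and a finite set of
    generators of it already lies in a member of the chain. The empty set is
    adjoined to [Fam] to provide a union for the empty chain. *)
Lemma noetherian_max (Fam : set (set A)) :
  (forall J, Fam J -> is_ideal J) -> Fam !=set0 ->
  exists2 J, Fam J & forall K, Fam K -> J `<=` K -> K `<=` J.
Proof.
move=> idF [J0 FJ0].
have [|J [[FJ|->] Jmax]] := @Zorn_bigcup _ (Fam `|` [set set0]).
- move=> F FF totF.
  have [F0|/existsNP[J1 /not_implyP[FJ1 J1n]]] := EM (forall J, F J -> J = set0).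
    by right; rewrite /= -subset0 => x [J /F0 ->].
  pose F' := [set J | F J /\ J != set0].
  have F'Fam J : F' J -> Fam J.
    by move=> [/FF[]// ->]; rewrite eqxx.
  have F'J1 : F' J1 by split=> //; exact/eqP.
  have chain J K : F' J -> F' K -> J `<=` K \/ K `<=` J.
    by move=> [FJ _] [FK _]; exact: totF.
  pose U := \bigcup_(J in F') J.
  have UE : \bigcup_(X in F) X = U.
    apply/seteqP; split=> x [J FJ Jx]; exists J => //; last by case: FJ.
    by split=> //; apply/set0P; exists x.
  have iU : is_ideal U.
    split.
    - by exists J1 => //; have [] := idF _ (F'Fam _ F'J1).
    - move=> x y [J FJ Jx] [K FK Ky]; have [JK|KJ] := chain J K FJ FK.
        exists K => //; have [_ D _] := idF _ (F'Fam _ FK); apply: D => //.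
        exact: JK.
      exists J => //; have [_ D _] := idF _ (F'Fam _ FJ); apply: D => //.
      exact: KJ.
    - move=> a x [J FJ Jx]; exists J => //.
      by have [_ _ M] := idF _ (F'Fam _ FJ); exact: M.
  have [S [/finite_seqP[s ->] US]] := noethA iU.
  have [J FJ sJ] : exists2 J, F' J & [set` s] `<=` J.
    have : [set` s] `<=` U by rewrite US; exact: sub_gen_ideal.
    elim: s {US} => [_|a s IH asU]; first by exists J1.
    have [|J FJ sJ] := IH; first by move=> x xs; apply: asU; rewrite /= inE xs orbT.
    have [K FK Ka] : U a by apply: asU; rewrite /= inE eqxx.
    have [JK|KJ] := chain J K FJ FK.
      by exists K => // x; rewrite /= inE => /orP[/eqP->//|/sJ/JK].
    by exists J => // x; rewrite /= inE => /orP[/eqP->|/sJ//]; exact: KJ.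
  left; rewrite UE (_ : U = J); first exact: F'Fam.
  apply/seteqP; split; last by move=> x Jx; exists J.
  by rewrite US; apply: gen_ideal_min => //; exact/idF/F'Fam.
- exists J => // K FK JK; apply: contrapT => nKJ.
  by apply: (Jmax K); [split | left].
- exfalso; apply: (Jmax J0); last by left.
  split=> //; first by move=> /(_ 0); apply; have [] := idF _ FJ0.
Qed.

(** Among the traces of [Y] on basic open sets, take a nonempty one with the
    largest vanishing ideal. Shrinking it further does not change this ideal, which
    is what makes it prime. *)
Lemma generic_point Y : constructible Y -> Y !=set0 ->
  exists2 p, Y p & exists2 s, s \notin p &
    forall q, Y q -> s \notin q -> specializations p q.
Proof.
move=> cY [q0 Yq0]; pose D s := Y `&` [set q : Spec A | s \notin q].
pose Fam := [set J | exists2 s, D s !=set0 & J = vanishing (D s)].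
have [||_ [s Ds ->] smax] := @noetherian_max Fam.
- by move=> _ [s _ ->]; exact: vanishing_ideal.
- exists (vanishing (D 1)), 1 => //; exists q0; split=> //; exact: notin_prime1.
have [|p pP] := vanishing_prime Ds.
  move=> a b vab; have [va|nva] := EM (vanishing (D s) a); [by left | right].
  have [q [Dq qa]] : exists q, D s q /\ a \notin q.
    by have /existsNP[q /not_implyP[Dq /negP qa]] := nva; exists q.
  have sub : vanishing (D s) `<=` vanishing (D (s * a)).
    by move=> c vc r [Yr]; rewrite /= prime_idealrM negb_or => /andP[rs _]; exact: vc.
  apply: (smax _ _ sub).
    exists (s * a) => //; exists q; case: Dq => Yq qs; split=> //.
    exact: notin_primeM.
  move=> r [Yr]; rewrite /= prime_idealrM negb_or => /andP[rs ra].
  by have := vab r (conj Yr rs); rewrite prime_idealrM (negbTE ra).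
have pD q : D s q -> specializations p q by move=> Dq a /pP; apply.
have ps : s \notin p.
  have [q Dq] := Ds; apply/negP => /(pD q Dq); apply/negP.
  by case: Dq.
exists p; last by exists s => // q Yq qs; exact: pD.
have [t pt tY] := cY p.
have [q [Dq qt]] : exists q, D s q /\ t \notin q.
  apply: contrapT => nq; move/negP: pt; apply; apply/pP => q Dq.
  by apply: contrapT => /negP qt; apply: nq; exists q.
by apply/(tY q (pD q Dq) qt); case: Dq.
Qed.

(** * Irredundant covers *)

Section IrredundantCover.
Variables (L : set (Spec A)) (M : Spec A -> set (Spec A)).
Hypothesis cL : constructible L.
Hypothesis cM : forall p, L p -> constructible (M p).
Hypothesis Mgen : forall p, L p -> M p p.
Hypothesis Mspec : forall p, M p `<=` specializations p.

(** With [M p] the stratum of [p], this is smallness of the cover. *)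
Definition irredundant (S : set (Spec A)) :=
  forall p q, S p -> S q -> M q p -> p = q.

Definition irredundant_cover (S : set (Spec A)) :=
  [/\ finite_set S, S `<=` L, L `<=` \bigcup_(p in S) M p & irredundant S].

Lemma finite_minimal (S : set (Spec A)) : finite_set S -> S !=set0 ->
  exists2 p, S p & forall q, S q -> {subset q <= p} -> q = p.
Proof.
move=> /finite_seqP[s ->]; elim: s => [[?]//|a s IH _].
have [s0|s0] := EM ([set` s] !=set0); last first.
  exists a; first by rewrite /= mem_head.
  move=> q; rewrite /= inE => /orP[/eqP//|qs _]; exfalso; apply: s0; by exists q.
have [m ms mmin] := IH s0; have [am|nam] := EM {subset a <= m}.
  exists a; first by rewrite /= mem_head.
  move=> q; rewrite /= inE => /orP[/eqP//|qs qa].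
  have qm : q = m by apply: mmin => // x /qa/am.
  by apply: Spec_eq => // x /am; rewrite qm.
exists m; first by rewrite /= inE (ms : m \in s) orbT.
by move=> q; rewrite /= inE => /orP[/eqP->/nam//|/mmin]; exact.
Qed.

Lemma irredundant_cover_step (S S' : set (Spec A)) p :
  irredundant_cover S -> irredundant_cover S' -> S p ->
  (forall q, {subset q <= p} -> q <> p -> S' q -> S q) -> S' p.
Proof.
move=> [_ SL _ irr] [_ _ cov' _] Sp below.
have [q S'q Mqp] := cov' p (SL p Sp).
have [<-//|qp] := EM (q = p).
exfalso; apply/qp/esym/irr => //; apply: below => //; exact: Mspec Mqp.
Qed.

Lemma irredundant_cover_uniq (S S' : set (Spec A)) :
  irredundant_cover S -> irredundant_cover S' -> S = S'.
Proof.
move=> cS cS'; have [finS _ _ _] := cS; have [finS' _ _ _] := cS'.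
pose T := (S `\` S') `|` (S' `\` S).
have [T0|nT0] := EM (T !=set0); last first.
  apply/seteqP; split=> p Sp; apply: contrapT => nSp; apply: nT0; exists p.
    by left.
  by right.
have finT : finite_set T by rewrite finite_setU; split; exact: finite_setD.
have [p Tp pmin] := finite_minimal finT T0.
have same q : {subset q <= p} -> q <> p -> (S q <-> S' q).
  move=> qp nqp; split=> h; apply: contrapT => nh; apply/nqp/pmin => //.
    by left.
  by right.
exfalso; case: Tp => -[h]; apply.
  by apply: (irredundant_cover_step cS) => // q qp nqp /(same q qp nqp).
by apply: (irredundant_cover_step cS') => // q qp nqp /(same q qp nqp).
Qed.

Lemma setD_bigcup_constructible (S : set (Spec A)) : finite_set S -> S `<=` L ->
  constructible (L `\` \bigcup_(p in S) M p).
Proof.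
move=> /finite_seqP[s ->] sL; apply: setI_constructible => //.
apply: setC_constructible => p.
suff [t pt tM] : exists2 t, t \notin p & forall r, r \in s -> forall q,
    {subset p <= q} -> t \notin q -> (M r q <-> M r p).
  by exists t => // q pq qt; split=> -[r rs /(tM r rs q pq qt) Mr]; exists r.
elim: s sL => [_|a s IH sL]; first by exists 1 => //; exact: notin_prime1.
have [|t pt tM] := IH; first by move=> x xs; apply: sL; rewrite /= inE xs orbT.
have [u pu uM] := cM (sL a (mem_head a s)) p.
exists (t * u); first exact: notin_primeM.
move=> r; rewrite inE => /orP[/eqP->|rs] q pq;
  rewrite prime_idealrM negb_or => /andP[qt qu]; [exact: uM | exact: tM].
Qed.

(** Take for [S] an irredundant set, below none of whose members a point of [L] is
    left uncovered, for which the vanishing ideal of the uncovered part is largest.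
    If that part is nonempty, it has a generic point [p] which is minimal in it, and
    [S] with [p] added is again such a set. A product [s f] with [s] isolating [V(p)]
    in the uncovered part and [f] isolating [M p] in [V(p)] vanishes on what remains
    uncovered, but not at [p]. *)
Lemma irredundant_cover_exists : exists S, irredundant_cover S.
Proof.
pose rest S := L `\` \bigcup_(p in S) M p.
(* The last condition on [S] makes generic points of the rest addable: no point
   of the rest lies below a member of [S]. *)
pose good S := [/\ finite_set S, S `<=` L, irredundant S &
  forall q p, rest S q -> S p -> ~ {subset q <= p}].
have [||_ [S [finS SL irr low] ->] Smax] :=
    @noetherian_max [set J | exists2 S, good S & J = vanishing (rest S)].
- by move=> _ [S _ ->]; exact: vanishing_ideal.
- exists (vanishing (rest set0)), set0 => //; split=> //; exact: finite_set0.
exists S; split=> // q Lq; apply: contrapT => nq.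
have [||p Up [s ps sU]] := @generic_point (rest S).
- exact: setD_bigcup_constructible.
- by exists q.
have [Lp nMp] := Up.
have pmin r : rest S r -> {subset r <= p} -> r = p.
  move=> Ur rp; apply: Spec_eq => //; apply: sU => //; exact: contraNN (rp s) ps.
pose S' := S `|` [set p].
have sub : rest S' `<=` rest S.
  by move=> r [Lr nr]; split=> // -[x Sx Mx]; apply: nr; exists x => //; left.
have goodS' : good S'.
  split.
  - by rewrite finite_setU; split=> //; exact: finite_set1.
  - by move=> r [/SL//|->].
  - move=> a b [Sa|->] [Sb|->]//; first exact: irr.
      by move=> /Mspec pa; exfalso; exact: (low p a).
    by move=> Mb; exfalso; apply: nMp; exists b.
  - move=> r a Ur [Sa|->] ra; first by apply: (low r a) => //; exact: sub.
    have rp := pmin r (sub r Ur) ra; case: Ur => _; apply; exists p; first by right.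
    by rewrite rp; exact: Mgen.
have [f pf fM] := cM Lp p.
have vS' : vanishing (rest S') (s * f).
  move=> r Ur; rewrite prime_idealrM; apply: contrapT => /negP.
  rewrite negb_or => /andP[rs rf]; have [_] := Ur; apply; exists p; first by right.
  apply/(fM r) => //; last exact: Mgen.
  by apply: sU => //; exact: sub.
have : vanishing (rest S) (s * f).
  apply: Smax vS'; first by exists S'.
  by move=> a va r /sub; exact: va.
by move=> /(_ p Up); rewrite prime_idealrM (negbTE ps) (negbTE pf).
Qed.

End IrredundantCover.
End VanishingIdeal.

(** * From irredundant covers to Groebner covers *)

Section Covers.
Variables (A : comNzRingType) (n : nat) (I : set {mpoly A[n]}) (le : rel 'X_{1..n}).
Hypotheses (iI : is_ideal I) (leT : term_order le).
Implicit Types (p q : Spec A) (c : piece A n).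

Lemma piece_eq c d : is_GY le I (projT2 c) -> is_GY le I (projT2 d) ->
  piece_set c = piece_set d :> set (Spec A) -> c = d.
Proof.
case: c d => Y G [Z H]; rewrite /piece_set /= => GG GH /lcset_eq YZ.
by subst Z; rewrite (is_GY_uniq leT GG GH).
Qed.

Section Fixed.
Variable L : set (Spec A).
Hypothesis lcL : locally_closed L.

Local Notation M := (stratum I leT L).

Definition stratum_piece p c :=
  is_GY le I (projT2 c) /\ piece_set c = M p :> set (Spec A).

Lemma stratum_spec p : M p `<=` specializations p.
Proof. by move=> q []. Qed.

Lemma stratum_inj p q : L p -> L q -> M p = M q -> p = q.
Proof.
move=> Lp Lq e; apply: Spec_eq.
  by apply: (@stratum_spec p); rewrite e; exact: stratum_generic.
by apply: (@stratum_spec q); rewrite -e; exact: stratum_generic.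
Qed.

Lemma stratum_piece_uniq p c d : stratum_piece p c -> stratum_piece p d -> c = d.
Proof. by move=> [Gc cE] [Gd dE]; apply: piece_eq => //; rewrite cE dE. Qed.

Lemma stratum_piece_exists p : L p -> exists c, stratum_piece p c.
Proof.
move=> Lp; have Mp : M p p by exact: stratum_generic.
have M0 : M p !=set0 by exists p.
pose Y := MkLcset (stratum_locally_closed I leT p lcL) M0.
pose y0 : lcpt Y := exist _ p Mp.
have [||G GG] := @extends_parametric A n le I leT iI Y y0.
- by move=> q [].
- by move=> q [].
by exists (existT _ Y G).
Qed.

Lemma parametric_stratum (Y : lcset A) p : parametric le I Y -> lccar Y p ->
  Y `<=` L -> Y `<=` specializations p -> Y `<=` M p.
Proof.
move=> parY Yp YL pY q Yq; split; [exact: YL | exact: pY |].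
by move=> g; exact: (@parametric_extends A n le I leT iI Y (exist _ p Yp) pY q parY Yq g).
Qed.

Definition stratification (S : set (Spec A)) : set (piece A n) :=
  [set c | exists2 p, S p & stratum_piece p c].

Definition canonical_cover (C : set (piece A n)) :=
  [/\ groebner_cover le I L C, irreducible_cover C, small_cover C &
      locally_maximal_cover le I L C].

(** Smallness holds because [p] itself is in no other stratum of the cover, and
    [M p] lies in [V(p)]. Local maximality is [parametric_stratum]. *)
Lemma stratification_canonical S :
  irredundant_cover L M S -> canonical_cover (stratification S).
Proof.
move=> [finS SL cov irr].
have gen p : S p -> M p p by move=> /SL; exact: stratum_generic.
split.
- split.
  + have [S0|/set0P[q Sq]] := eqVneq S set0.
      apply: sub_finite_set (finite_set0 _) => c [p].
      by rewrite S0.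
    have /choice[phi phiP] p : exists c, S p -> stratum_piece p c.
      have [/SL Lp|nSp] := EM (S p).
        by have [c cp] := stratum_piece_exists Lp; exists c.
      by have [c _] := stratum_piece_exists (SL q Sq); exists c.
    apply: sub_finite_set (finite_image phi finS) => c [p Sp cp].
    by exists p => //; apply: (stratum_piece_uniq _ cp); exact: phiP.
  + by move=> c [p _ []].
  + apply/seteqP; split=> q.
      move=> /cov[p Sp Mpq]; have [c cp] := stratum_piece_exists (SL p Sp).
      by exists c; [exists p | case: cp => _ ->].
    by move=> [c [p _ [_ ->]] []].
- move=> c [p Sp [_ ->]]; split; first by exists p; exact: gen.
  move=> F1 F2 cF1 cF2 cov12; have [Fp|Fp] := cov12 p (gen p Sp); [left|right];
    by move=> q /stratum_spec pq; exact: closed_specialization Fp.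
- move=> c [p Sp cp]; have [_ cE] := cp.
  have cpp : lccar (piece_set c) p by rewrite cE; exact: gen.
  have cspec : piece_set c `<=` specializations p by rewrite cE; exact: stratum_spec.
  rewrite (closure_generic cpp cspec); apply: closure_generic; last by move=> q [/cspec].
  split=> // -[d [[q Sq dq] dc]]; have [_ ->] := dq => Mqp.
  by apply: dc; apply: (stratum_piece_uniq dq); rewrite -(irr p q Sp Sq Mqp).
- move=> c [p Sp [_ cE]] Y parY YL cY Ycl.
  have Yp : lccar Y p by apply: cY; rewrite cE; exact: gen.
  apply/seteqP; split=> //; rewrite cE; apply: parametric_stratum => //.
  by apply: subset_trans Ycl _; rewrite cE (closure_generic (gen p Sp) (@stratum_spec p)).
Qed.

Lemma canonical_cover_piece C c : canonical_cover C -> C c ->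
  exists2 p, L p & stratum_piece p c.
Proof.
move=> [[_ GC LC] irrC _ maxC] Cc.
have [p cp pc] := irreducible_generic (irrC c Cc) (lccar_lc (piece_set c)).
have cL : piece_set c `<=` L by rewrite LC => q cq; exists c.
have Lp := cL p cp; have [d [Gd dE]] := stratum_piece_exists Lp.
exists p => //; split; first exact: GC.
rewrite -dE; apply: (maxC c Cc (piece_set d)).
- by exists (projT2 d).
- by rewrite dE => q [].
- by rewrite dE; apply: parametric_stratum => //; exists (projT2 c); exact: GC.
- by rewrite dE (closure_generic cp pc); exact: stratum_spec.
Qed.

(** If [p] in [S] belonged to [M q] with [q] in [S] distinct from [p], some [f]
    outside [p] would vanish on [M p] minus [M q], contradicting smallness at [p]. *)
Lemma canonical_cover_stratification C : canonical_cover C ->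
  exists2 S, irredundant_cover L M S & C = stratification S.
Proof.
move=> gC; have [[finC GC LC] _ smallC _] := gC.
pose S := [set p | L p /\ exists2 c, C c & stratum_piece p c].
have CE : C = stratification S.
  apply/seteqP; split=> c.
    move=> Cc; have [p Lp cp] := canonical_cover_piece gC Cc.
    by exists p => //; split=> //; exists c.
  by move=> [p [Lp [d Cd dp]] cp]; rewrite (stratum_piece_uniq cp dp).
exists S => //; split.
- have /choice[psi psiP] c : exists p, C c -> S p /\ stratum_piece p c.
    have [Cc|nCc] := EM (C c).
      have [p Lp cp] := canonical_cover_piece gC Cc.
      by exists p => _; split=> //; split=> //; exists c.
    by have [p _] := lccar_n0 (piece_set c); exists p.
  apply: sub_finite_set (finite_image psi finC) => p [Lp [c Cc [Gc cE]]].
  exists c => //; have [[Lq _] [_ cE']] := psiP c Cc.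
  by apply: stratum_inj => //; rewrite -cE -cE'.
- by move=> p [].
- rewrite {1}LC CE => q [c [p Sp [_ cE]]]; rewrite /= cE => Mpq; by exists p.
- move=> p q [Lp [c Cc cp]] [Lq [d Cd dq]] Mqp; apply: contrapT => pq.
  have [f pf fM] := locally_closed_constructible (stratum_locally_closed I leT q lcL) p.
  have [_ cE] := cp; have [_ dE] := dq.
  have cd : d <> c by move=> e; apply: pq; apply: stratum_inj => //; rewrite -cE -dE e.
  have : closure (piece_set c `\` \bigcup_(c' in C `\ c) piece_set c') p.
    by rewrite smallC//; apply: subset_closure; rewrite cE; exact: stratum_generic.
  move=> /closureP/(_ f) fp; move/negP: pf; apply; apply: fp => r [].
  rewrite cE => /stratum_spec pr nr; apply: contrapT => /negP rf.
  by apply: nr; exists d => //; rewrite dE; apply/(fM r pr rf).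
Qed.

End Fixed.
End Covers.

Theorem theorem11 (A : comNzRingType) (n : nat) (I : set {mpoly A[n]})
    (le : rel 'X_{1..n}) (L : set (Spec A)) :
  noetherian A -> reduced_ring A -> is_ideal I -> term_order le ->
  locally_closed L ->
  exists! C : set (piece A n),
    [/\ groebner_cover le I L C, irreducible_cover C, small_cover C &
        locally_maximal_cover le I L C].
Proof.
move=> noethA _ iI leT lcL.
have Mspec := @stratum_spec _ _ I _ leT L.
have [|||S cS] := @irredundant_cover_exists A noethA L (stratum I leT L) _ _ _ Mspec.
- exact: locally_closed_constructible.
- by move=> p _; exact/locally_closed_constructible/stratum_locally_closed.
- by move=> p; exact: stratum_generic.
exists (stratification I leT L S); split; first exact: stratification_canonical.
move=> C gC; have [S' cS' ->] := canonical_cover_stratification iI leT lcL gC.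
by rewrite (irredundant_cover_uniq Mspec cS cS').
Qed.
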